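(* A connected finite-dimensional $\Bbbk$-algebra is hom-irreducible if and only if it is Morita equivalent to $\Lambda_m=\Bbbk[x]/(x^m)$ for some $m\in\mathbb N_+$.
   Context: $\Bbbk$ is algebraically closed. For a bound quiver algebra $\Lambda=\Bbbk Q/I$ ($Q$ a finite quiver, $I$ an ideal generated by linear combinations of paths of length $\ge2$ with common start and end, containing all paths of length $\ge n$ for some $n$), $\mathrm{rep}_\Lambda(\mathbf d)$ is the variety of representations $V=(V_\alpha)$, $V_\alpha\in M_{d_{t\alpha}\times d_{s\alpha}}(\Bbbk)$, satisfying the relations of $I$. $\mathcal H_\Lambda(\mathbf e,\mathbf d)$ is the variety of triples $(V,W,f)$ with $V\in\mathrm{rep}_\Lambda(\mathbf e)$, $W\in\mathrm{rep}_\Lambda(\mathbf d)$, $f=(f_x)$, $f_x\in M_{d_x\times e_x}(\Bbbk)$, $W_\alpha f_{s\alpha}=f_{t\alpha}V_\alpha$ for all arrows $\alpha$. $\Lambda$ is hom-irreducible if $\mathcal H_\Lambda(\mathbf e,\mathbf d)$ is irreducible for all dimension vectors $\mathbf d,\mathbf e$. A general finite-dimensional algebra is called hom-irreducible if a Morita-equivalent bound quiver algebra is (this is independent of the choice). *)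

(* Defs.v *)
From HB Require Import structures.
From mathcomp Require Import all_boot all_order all_algebra all_field.
Set Implicit Arguments. Unset Strict Implicit. Unset Printing Implicit Defensive.
Import Order.TTheory GRing.Theory.
Local Open Scope ring_scope.

Section Zariski.
Variables (K : fieldType) (T : Type) (coord : (T -> K) -> Prop).

Inductive polyfun : (T -> K) -> Prop :=
| pf_const (c : K) : polyfun (fun _ => c)
| pf_coord f : coord f -> polyfun f
| pf_add f g : polyfun f -> polyfun g -> polyfun (fun x => f x + g x)
| pf_mul f g : polyfun f -> polyfun g -> polyfun (fun x => f x * g x).

Definition zclosed (Z : T -> Prop) : Prop :=
  exists F : (T -> K) -> Prop, (forall f, F f -> polyfun f) /\
    forall x, Z x <-> (forall f, F f -> f x = 0).

Definition zirreducible (X : T -> Prop) : Prop :=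
  (exists x, X x) /\
  forall Z1 Z2, zclosed Z1 -> zclosed Z2 ->
    (forall x, X x -> Z1 x \/ Z2 x) ->
    (forall x, X x -> Z1 x) \/ (forall x, X x -> Z2 x).
End Zariski.

Record quiver := Quiver {
  vert : finType; arr : finType; src : arr -> vert; tgt : arr -> vert }.

Section Quiver.
Variable Q : quiver.

(* A path is a starting vertex together with the list of its arrows in
   order of traversal (the trivial path e_x is (x, [::])). *)
Definition qpath := (vert Q * seq (arr Q))%type.

Fixpoint valid_from (x : vert Q) (w : seq (arr Q)) : bool :=
  if w is a :: w' then (src a == x) && valid_from (tgt a) w' else true.
Definition endpt (x : vert Q) (w : seq (arr Q)) : vert Q :=
  foldl (fun _ a => tgt a) x w.
Definition pvalid (p : qpath) : bool := valid_from p.1 p.2.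

Variable K : fieldType.

(* elements of the path algebra kQ as formal linear combinations of paths;
   entries whose "path" is not a valid path are ignored (count as 0) *)
Definition kQ := seq (K * qpath).
Definition coeff (u : kQ) (q : qpath) : K :=
  \sum_(c <- u | pvalid c.2 && (c.2 == q)) c.1.

Record qrel := QRel { rs : vert Q; rt : vert Q; rterms : seq (K * seq (arr Q)) }.
Definition rel_wf (r : qrel) : bool :=
  all (fun c => [&& valid_from (rs r) c.2, endpt (rs r) c.2 == rt r
                  & (2 <= size c.2)%N]) (rterms r).

(* element c * a * r * b of kQ (b traversed first, then r, then a) *)
Definition rel_mult (t : K * qpath * qrel * qpath) : kQ :=
  let: (c, a, r, b) := t in
  if [&& pvalid b, endpt b.1 b.2 == rs r, pvalid a & a.1 == rt r]
  then [seq (c * ct.1, (b.1, b.2 ++ ct.2 ++ a.2)) | ct <- rterms r]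
  else [::].

Definition in_ideal (rels : qrel -> Prop) (u : kQ) : Prop :=
  exists s : seq (K * qpath * {r : qrel | rels r} * qpath),
    forall q, pvalid q ->
      coeff u q = coeff (flatten [seq rel_mult (t.1.1.1, t.1.1.2, proj1_sig t.1.2, t.2)
                                 | t <- s]) q.
End Quiver.

Record bquiver (K : fieldType) := BQuiver {
  bq : quiver;
  brels : qrel bq K -> Prop;
  brels_wf : forall r, brels r -> rel_wf r;
  bnilp : exists n : nat, forall q : qpath bq, pvalid q -> (n <= size q.2)%N ->
            in_ideal brels [:: (1, q)] }.

Section Reps.
Variables (K : fieldType) (L : bquiver K).
Local Notation Q := (bq L).

Definition qrep (d : vert Q -> nat) :=
  forall a : arr Q, 'M[K]_(d (tgt a), d (src a)).

Fixpoint pev (d : vert Q -> nat) (V : qrep d) (x : vert Q) (w : seq (arr Q))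
  : 'M[K]_(d (endpt x w), d x) :=
  match w with
  | [::] => 1%:M
  | a :: w' => pev V (tgt a) w' *m conform_mx 0 (V a)
  end.

Definition satisfies_rel d (V : qrep d) (r : qrel Q K) : Prop :=
  \sum_(c <- rterms r) c.1 *: (conform_mx 0 (pev V (rs r) c.2)
                                 : 'M[K]_(d (rt r), d (rs r))) = 0.

Definition in_rep d (V : qrep d) : Prop :=
  forall r, @brels K L r -> satisfies_rel V r.

Definition Htype (e d : vert Q -> nat) :=
  (qrep e * qrep d * (forall x : vert Q, 'M[K]_(d x, e x)))%type.

Definition Hcoord (e d : vert Q -> nat) (f : Htype e d -> K) : Prop :=
  (exists a i j, f = fun P => P.1.1 a i j) \/
  (exists a i j, f = fun P => P.1.2 a i j) \/
  (exists x i j, f = fun P => P.2 x i j).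

Definition Hset (e d : vert Q -> nat) (P : Htype e d) : Prop :=
  in_rep P.1.1 /\ in_rep P.1.2 /\
  forall a : arr Q, P.1.2 a *m P.2 (src a) = P.2 (tgt a) *m P.1.1 a.

Definition bq_hom_irreducible : Prop :=
  forall e d : vert Q -> nat, zirreducible (@Hcoord e d) (@Hset e d).
End Reps.

Section Algebras.
Variables (K : fieldType) (A : falgType K).

(* A is connected: its only central idempotents are 0 and 1 (A <> 0 is
   built into falgType, which is a non-trivial ring). *)
Definition connected_alg : Prop :=
  forall z : A, z * z = z -> (forall a : A, a * z = z * a) -> z = 0 \/ z = 1.

Definition scalemx m n (c : K) (M : 'M[A]_(m, n)) : 'M[A]_(m, n) :=
  map_mx (fun a => c *: a) M.

Definition full_idem n (e : 'M[A]_n) : Prop :=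
  e *m e = e /\
  exists s : seq ('M[A]_n * 'M[A]_n), \sum_(ab <- s) ab.1 *m e *m ab.2 = 1%:M.

(* Morita equivalence with a bound quiver algebra Lambda = kQ/I:
   Lambda is isomorphic to e M_n(A) e = End_A(P) for the progenerator
   P = e A^n, the isomorphism being induced by an algebra homomorphism
   kQ -> e M_n(A) e (images E_x of the trivial paths, X_a of the arrows)
   which is onto and whose kernel is exactly I. *)
Definition morita_bq (L : bquiver K) : Prop :=
  exists n (e : 'M[A]_n.+1), full_idem e /\
  exists (E : vert (bq L) -> 'M[A]_n.+1) (X : arr (bq L) -> 'M[A]_n.+1),
    (forall x, E x *m E x = E x) /\
    (forall x y, x != y -> E x *m E y = 0) /\
    \sum_x E x = e /\
    (forall a, X a = E (tgt a) *m X a *m E (src a)) /\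
    let peval (q : qpath (bq L)) :=
      if pvalid q then foldl (fun acc a => X a *m acc) (E q.1) q.2 else 0 in
    let eval (u : kQ (bq L) K) := \sum_(c <- u) scalemx c.1 (peval c.2) in
    (forall u, eval u = 0 <-> in_ideal (@brels K L) u) /\
    (forall M, e *m M *m e = M -> exists u, eval u = M).

Definition hom_irreducible_alg : Prop :=
  exists L : bquiver K, morita_bq L /\ bq_hom_irreducible L.

(* Morita equivalence with Lambda_m = k[x]/(x^m): e M_n(A) e is isomorphic
   to k[x]/(x^m) via p |-> p(x) (x^0 |-> e), i.e. this map from k[x] is
   onto e M_n(A) e with kernel exactly (x^m). *)
Definition morita_trunc_poly (m : nat) : Prop :=
  exists n (e : 'M[A]_n.+1), full_idem e /\
  exists x : 'M[A]_n.+1, e *m x *m e = x /\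
    let eval (p : {poly K}) := \sum_(i < size p) scalemx p`_i (e *m x ^+ i) in
    (forall p, eval p = 0 <-> ('X^m %| p)) /\
    (forall M, e *m M *m e = M -> exists p, eval p = M).
End Algebras.

(* Main.v *)
(* If alpha is an arrow between distinct vertices, or alpha and beta are two
   loops at the same vertex, an explicit hom variety in dimensions 1 or 2 is the
   union of two proper closed subsets.  So the quiver of a hom-irreducible
   algebra has at most one loop at each vertex and no other arrow; the trivial
   paths are then central idempotents, and connectedness leaves one vertex.

   Conversely, irreducibility of the variety of homomorphisms g : M -> N between
   modules over K[x]/(x^m) goes by induction on m.  Given N' = xN and a submodule
   M' of M containing xM, killed by x^(m-1) and mapped into N', the triple is
   determined by its restriction M' -> N', which is defined over K[x]/(x^(m-1)),
   together with parameters in an affine space.  Hence the triples with prescribed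
   dim M' and dim xN form an irreducible family, and it remains to deform any
   triple to one where xM and xN have maximal dimension.  If xM is too small and
   some element outside xM, killed by x^(m-1), is mapped into xN, add it to xM to
   form M': the family contains a point with larger xM.  Dually for N.  If both moves are
   impossible, then M and N split as free + M0 and free + N0 with g : M0 -> N0 an
   isomorphism, and M0 can be deformed on both sides simultaneously. *)

From Stdlib Require Import FunctionalExtensionality Classical.
Require Import Defs.
From HB Require Import structures.
From mathcomp Require Import all_boot all_order all_algebra all_field.
From mathcomp Require Import zify ring.
Set Implicit Arguments. Unset Strict Implicit. Unset Printing Implicit Defensive.
Import Order.TTheory GRing.Theory.
Local Open Scope ring_scope.

(** * Polynomial functions and irreducible sets *)

Section PolynomialFunctions.
Variables (K : fieldType) (T : Type) (coord : (T -> K) -> Prop).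
Local Notation pf := (polyfun coord).

Lemma pf_ext f g : f =1 g -> pf f -> pf g.
Proof. by move=> /functional_extensionality ->. Qed.

Lemma pf_scale c f : pf f -> pf (fun x => c * f x).
Proof. exact: (pf_mul (pf_const _ c)). Qed.

Lemma pf_opp f : pf f -> pf (fun x => - f x).
Proof. by move=> pf_f; apply: (pf_ext _ (pf_scale (-1) pf_f)) => x; rewrite mulN1r. Qed.

Lemma pf_sub f g : pf f -> pf g -> pf (fun x => f x - g x).
Proof. by move=> pf_f /pf_opp; apply: pf_add. Qed.

Lemma pf_sum I (r : seq I) (P : pred I) (F : I -> T -> K) :
  (forall i, pf (F i)) -> pf (fun x => \sum_(i <- r | P i) F i x).
Proof.
move=> pfF; elim: r => [|i r IHr].
  by apply: (pf_ext _ (pf_const _ 0)) => x; rewrite big_nil.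
case: (boolP (P i)) => Pi.
  by apply: (pf_ext _ (pf_add (pfF i) IHr)) => x; rewrite big_cons Pi.
by apply: (pf_ext _ IHr) => x; rewrite big_cons (negbTE Pi).
Qed.

Lemma pf_prod I (r : seq I) (F : I -> T -> K) :
  (forall i, pf (F i)) -> pf (fun x => \prod_(i <- r) F i x).
Proof.
move=> pfF; elim: r => [|i r IHr].
  by apply: (pf_ext _ (pf_const _ 1)) => x; rewrite big_nil.
by apply: (pf_ext _ (pf_mul (pfF i) IHr)) => x; rewrite big_cons.
Qed.

Definition regmx a b (A : T -> 'M[K]_(a, b)) : Prop :=
  forall i j, pf (fun s => A s i j).

Lemma regmx_ext a b (A B : T -> 'M[K]_(a, b)) : A =1 B -> regmx A -> regmx B.
Proof. by move=> /functional_extensionality ->. Qed.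

Lemma regmx_const a b (A : 'M[K]_(a, b)) : regmx (fun=> A).
Proof. by move=> i j; apply: pf_const. Qed.

Lemma regmx_add a b (A B : T -> 'M[K]_(a, b)) :
  regmx A -> regmx B -> regmx (fun s => A s + B s).
Proof.
by move=> rA rB i j; apply: (pf_ext _ (pf_add (rA i j) (rB i j))) => s; rewrite mxE.
Qed.

Lemma regmx_sub a b (A B : T -> 'M[K]_(a, b)) :
  regmx A -> regmx B -> regmx (fun s => A s - B s).
Proof.
by move=> rA rB i j; apply: (pf_ext _ (pf_sub (rA i j) (rB i j))) => s; rewrite !mxE.
Qed.

Lemma regmx_scale a b c (A : T -> 'M[K]_(a, b)) :
  pf c -> regmx A -> regmx (fun s => c s *: A s).
Proof.
by move=> rc rA i j; apply: (pf_ext _ (pf_mul rc (rA i j))) => s; rewrite mxE.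
Qed.

Lemma regmx_mul a b c (A : T -> 'M[K]_(a, b)) (B : T -> 'M[K]_(b, c)) :
  regmx A -> regmx B -> regmx (fun s => A s *m B s).
Proof.
move=> rA rB i j.
apply: (@pf_ext (fun s => \sum_k A s i k * B s k j)) => [s|]; first by rewrite mxE.
by apply: pf_sum => k; apply: pf_mul.
Qed.

Lemma regmx_tr a b (A : T -> 'M[K]_(a, b)) : regmx A -> regmx (fun s => (A s)^T).
Proof. by move=> rA i j; apply: (pf_ext _ (rA j i)) => s; rewrite mxE. Qed.

Lemma regmx_row a b c (A : T -> 'M[K]_(a, b)) (B : T -> 'M[K]_(a, c)) :
  regmx A -> regmx B -> regmx (fun s => row_mx (A s) (B s)).
Proof.
move=> rA rB i j; case: (split_ordP j) => k ->.
  by apply: (pf_ext _ (rA i k)) => s; rewrite row_mxEl.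
by apply: (pf_ext _ (rB i k)) => s; rewrite row_mxEr.
Qed.

Lemma regmx_col a b c (A : T -> 'M[K]_(a, c)) (B : T -> 'M[K]_(b, c)) :
  regmx A -> regmx B -> regmx (fun s => col_mx (A s) (B s)).
Proof.
move=> rA rB; apply: (@regmx_ext _ _ (fun s => (row_mx (A s)^T (B s)^T)^T)).
  by move=> s; rewrite tr_row_mx !trmxK.
by apply/regmx_tr/regmx_row; apply: regmx_tr.
Qed.

Lemma pf_det n (A : T -> 'M[K]_n) : regmx A -> pf (fun s => \det (A s)).
Proof.
move=> rA; apply: pf_sum => sigma; apply: pf_scale; exact: pf_prod.
Qed.

Lemma regmx_adj n (A : T -> 'M[K]_n) : regmx A -> regmx (fun s => \adj (A s)).
Proof.
move=> rA i j.
apply: (@pf_ext (fun s => (-1) ^+ (j + i) * \det (row' j (col' i (A s))))).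
  by move=> s; rewrite mxE.
apply/pf_scale/pf_det => k l.
by apply: (pf_ext _ (rA (lift j k) (lift i l))) => s; rewrite !mxE.
Qed.

End PolynomialFunctions.

(** * Regular functions and irreducible subsets of vector spaces *)

Section RegularFunctions.
Variable K : closedFieldType.

(** All linear forms serve as coordinates, so no basis has to be chosen and products of matrix
    spaces need no separate treatment. *)
Definition regfun (U : lmodType K) : (U -> K) -> Prop :=
  polyfun (fun f : U -> K => scalar f).
Local Notation regmx A := (regmx (fun f => scalar f) A).

Definition regmap (S U : lmodType K) (phi : S -> U) : Prop :=
  forall f : U -> K, scalar f -> regfun (f \o phi).

Lemma regfun_comp (S U : lmodType K) (F : U -> K) (phi : S -> U) :
  regfun F -> regmap phi -> regfun (F \o phi).
Proof.
move=> pF rphi; elim: pF => [c|f /rphi //|f g _ pf1 _ pg1|f g _ pf1 _ pg1].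
- exact: pf_const.
- exact: (pf_add pf1 pg1).
- exact: (pf_mul pf1 pg1).
Qed.

Lemma scalarD (U : lmodType K) (f : U -> K) x y : scalar f -> f (x + y) = f x + f y.
Proof. by move=> lf; rewrite -[x]scale1r lf mul1r scale1r. Qed.

Lemma scalar0 (U : lmodType K) (f : U -> K) : scalar f -> f 0 = 0.
Proof.
move=> lf; have /eqP := scalarD 0 0 lf.
by rewrite addr0 -{1}[f 0]addr0 (inj_eq (addrI _)) eq_sym => /eqP.
Qed.

Lemma scalarZ (U : lmodType K) (f : U -> K) c x : scalar f -> f (c *: x) = c * f x.
Proof. by move=> lf; rewrite -[c *: x]addr0 lf scalar0 // addr0. Qed.

Lemma scalar_sum (U : lmodType K) (f : U -> K) I (r : seq I) (F : I -> U) :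
  scalar f -> f (\sum_(i <- r) F i) = \sum_(i <- r) f (F i).
Proof.
move=> lf; elim: r => [|i r IHr]; first by rewrite !big_nil scalar0.
by rewrite !big_cons scalarD ?IHr.
Qed.

Lemma regmap_mx (S : lmodType K) a b (A : S -> 'M[K]_(a, b)) : regmx A -> regmap A.
Proof.
move=> rA f lf.
apply: (@pf_ext _ _ _ (fun s => \sum_i \sum_j f (delta_mx i j) * A s i j)); last first.
  by apply: pf_sum => i; apply: pf_sum => j; apply/pf_scale/rA.
move=> s; rewrite /= {2}(matrix_sum_delta (A s)) scalar_sum //.
apply: eq_bigr => i _; rewrite scalar_sum //; apply: eq_bigr => j _.
by rewrite scalarZ // mulrC.
Qed.

Lemma regmx_regmap (S : lmodType K) a b (A : S -> 'M[K]_(a, b)) : regmap A -> regmx A.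
Proof. by move=> rA i j; apply: (rA (fun M => M i j)) => c x y; rewrite !mxE. Qed.

Lemma regmap_fst (S U V : lmodType K) (phi : S -> (U * V)%type) :
  regmap phi -> regmap (fun s => (phi s).1).
Proof. by move=> rphi f lf; apply: (rphi (fun x => f x.1)) => c x y; apply: lf. Qed.

Lemma regmap_snd (S U V : lmodType K) (phi : S -> (U * V)%type) :
  regmap phi -> regmap (fun s => (phi s).2).
Proof. by move=> rphi f lf; apply: (rphi (fun x => f x.2)) => c x y; apply: lf. Qed.

Lemma regmap_id (S : lmodType K) : regmap (fun s : S => s).
Proof. by move=> f lf; apply: pf_coord. Qed.

Lemma regmap_scalar (S : lmodType K) (phi : S -> K^o) : regmap phi -> regfun phi.
Proof. by move=> rphi; apply: (rphi (fun x => x)). Qed.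

Lemma regmap_pair (S U V : lmodType K) (phi : S -> U) (psi : S -> V) :
  regmap phi -> regmap psi -> regmap (fun s => (phi s, psi s)).
Proof.
move=> rphi rpsi f lf.
have l1 : scalar (fun u : U => f (u, 0)).
  by move=> a x y; rewrite -lf /=; congr f; congr (_, _); rewrite /= scaler0 addr0.
have l2 : scalar (fun v : V => f (0, v)).
  by move=> a x y; rewrite -lf /=; congr f; congr (_, _); rewrite /= scaler0 addr0.
apply: (pf_ext _ (pf_add (rphi _ l1) (rpsi _ l2))) => s /=.
by rewrite -scalarD //; congr f; congr (_, _); rewrite /= ?addr0 ?add0r.
Qed.

Lemma regfun_line (U : lmodType K) (F : U -> K) (x y : U) : regfun F ->
  exists p : {poly K}, forall t, F (x + t *: (y - x)) = p.[t].
Proof.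
elim=> [c|f lf|f g _ [p Hp] _ [q Hq]|f g _ [p Hp] _ [q Hq]].
- by exists c%:P => t; rewrite hornerC.
- exists ((f x)%:P + (f (y - x))%:P * 'X) => t.
  by rewrite scalarD // scalarZ // !hornerE mulrC.
- by exists (p + q) => t; rewrite hornerD Hp Hq.
- by exists (p * q) => t; rewrite hornerM Hp Hq.
Qed.

(** Irreducibility tested on basic open sets: two of them that meet [X] have a common point in [X].
    The empty set qualifies; nonemptiness is supplied separately in [zirreducible_image]. *)
Definition zirr (U : lmodType K) (X : U -> Prop) : Prop :=
  forall F1 F2, regfun F1 -> regfun F2 ->
    (exists2 x, X x & F1 x != 0) -> (exists2 x, X x & F2 x != 0) ->
    exists x, [/\ X x, F1 x != 0 & F2 x != 0].

(** On the line through the two given points both functions become nonzero polynomials in one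
    variable, and over an algebraically closed field their product has a nonroot. *)
Lemma zirr_full (V : lmodType K) : zirr (fun _ : V => True).
Proof.
move=> F1 F2 p1 p2 [x1 _ n1] [x2 _ n2].
have [q1 Hq1] := regfun_line x1 x2 p1; have [q2 Hq2] := regfun_line x1 x2 p2.
have : q1 * q2 != 0.
  rewrite mulf_neq0 //; apply/eqP => q0.
    by move: n1; rewrite -[x1]addr0 -(scale0r (x2 - x1)) Hq1 q0 horner0 eqxx.
  by move: n2; rewrite -[x2](addrNK x1) addrC -[x2 - x1]scale1r Hq2 q0 horner0 eqxx.
move=> /closed_nonrootP [t]; rewrite rootM negb_or /root -Hq1 -Hq2 => /andP[n1' n2'].
by exists (x1 + t *: (x2 - x1)).
Qed.

(** Move first in the base, keeping the two fibre coordinates [a1] and [a2] fixed, to reach a common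
    [x]; then move in the fibre over [x], an affine space. *)
Lemma zirr_affine (U V : lmodType K) (X : U -> Prop) :
  zirr X -> zirr (fun s : (U * V)%type => X s.1).
Proof.
move=> iX F1 F2 p1 p2 [[x1 a1] /= X1 n1] [[x2 a2] /= X2 n2].
have rl a : regmap (fun x : U => (x, a) : (U * V)%type).
  move=> f lf; apply: (@pf_ext _ _ _ (fun x => f (x, 0) + f (0, a))).
    by move=> x /=; rewrite -scalarD //; congr f; congr (_, _); rewrite /= ?addr0 ?add0r.
  apply: pf_add; last exact: pf_const.
  apply: pf_coord => c x y; rewrite -lf; congr f; congr (_, _).
  by rewrite /= scaler0 addr0.
have rr x : regmap (fun a : V => (x, a) : (U * V)%type).
  move=> f lf; apply: (@pf_ext _ _ _ (fun a => f (0, a) + f (x, 0))).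
    by move=> a /=; rewrite -scalarD //; congr f; congr (_, _); rewrite /= ?addr0 ?add0r.
  apply: pf_add; last exact: pf_const.
  apply: pf_coord => c a b; rewrite -lf; congr f; congr (_, _).
  by rewrite /= scaler0 addr0.
have [||x [Xx m1 m2]] := iX _ _ (regfun_comp p1 (rl a1)) (regfun_comp p2 (rl a2)).
- by exists x1.
- by exists x2.
have [||a [_ k1 k2]] := zirr_full (regfun_comp p1 (rr x)) (regfun_comp p2 (rr x)).
- by exists a1.
- by exists a2.
by exists (x, a).
Qed.

Lemma zirr_image (S U : lmodType K) (X : S -> Prop) (phi : S -> U) :
  zirr X -> regmap phi -> zirr (fun u => exists2 s, X s & u = phi s).
Proof.
move=> iX rphi F1 F2 p1 p2 [_ [s1 X1 ->] n1] [_ [s2 X2 ->] n2].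
have [||s [Xs m1 m2]] := iX _ _ (regfun_comp p1 rphi) (regfun_comp p2 rphi).
- by exists s1.
- by exists s2.
by exists (phi s); split=> //; exists s.
Qed.

End RegularFunctions.

(** * Nilpotent matrices *)

Section NilpotentMatrices.
Variable K : fieldType.

Lemma expmxS p (A : 'M[K]_p) n : A ^+ n.+1 = A *m A ^+ n.
Proof. exact: exprS. Qed.

Lemma expmxSr p (A : 'M[K]_p) n : A ^+ n.+1 = A ^+ n *m A.
Proof. exact: exprSr. Qed.

Lemma expmxD p (A : 'M[K]_p) i j : A ^+ (i + j) = A ^+ i *m A ^+ j.
Proof. exact: exprD. Qed.

Lemma tr_expmx p (A : 'M[K]_p) n : (A ^+ n)^T = A^T ^+ n.
Proof.
elim: n => [|n IHn]; first by rewrite !expr0 trmx1.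
by rewrite expmxS trmx_mul IHn -expmxSr.
Qed.

Lemma expmx_intertw p q (A : 'M[K]_p) (B : 'M[K]_q) (g : 'M_(p, q)) n :
  A *m g = g *m B -> A ^+ n *m g = g *m B ^+ n.
Proof.
move=> AgB; elim: n => [|n IHn]; first by rewrite !expr0 mul1mx mulmx1.
by rewrite expmxS -mulmxA IHn mulmxA AgB -mulmxA -expmxS.
Qed.

Lemma nil_expmx p (A : 'M[K]_p) m k : A ^+ m = 0 -> (m <= k)%N -> A ^+ k = 0.
Proof. by move=> Am0 /subnK <-; rewrite expmxD Am0 mulmx0. Qed.

(** A quantitative Nakayama lemma for the quotient by [S]: each layer between [S + B ^ i] and
    [S + B ^ i.+1] is spanned by the image under [B ^ i] of a complement of [S + B], so it has
    dimension at most [d], and there are [n] layers. *)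
Lemma codim_nilpotent n q (B : 'M[K]_q) k (S : 'M_(k, q)) :
  B ^+ n = 0 -> (S *m B <= S)%MS ->
  (q - \rank S <= n * (q - \rank (S + B)))%N.
Proof.
move=> Bn0 SB; pose d := (q - \rank (S + B))%N; rewrite -/d.
have SBi i : (S *m B ^+ i <= S)%MS.
  elim: i => [|i IHi]; first by rewrite expr0 mulmx1.
  by rewrite expmxS mulmxA; apply: submx_trans (submxMr _ SB) IHi.
suff H i : (q <= \rank (S + B ^+ i) + i * d)%N.
  by rewrite leq_subLR; have := H n; rewrite Bn0 addsmx0.
elim: i => [|i IHi].
  by rewrite expr0 mul0n addn0 -{1}(mxrank1 K q) mxrankS ?addsmxSr.
apply: (leq_trans IHi); rewrite mulSn addnA leq_add2r.
set D := (S + B)^C%MS.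
have rD : \rank D = d by rewrite mxrank_compl.
have sub : (S + B ^+ i <= (S + B ^+ i.+1) + D *m B ^+ i)%MS.
  rewrite addsmx_sub (submx_trans (addsmxSl _ _) (addsmxSl _ _)) /=.
  rewrite -{1}[B ^+ i]mul1mx.
  apply: submx_trans (submxMr _ (_ : 1%:M <= (S + B) + D)%MS) _.
    by rewrite sub1mx addsmx_compl_full.
  rewrite addsmxMr addsmx_sub addsmxSr andbT addsmxMr addsmx_sub.
  rewrite (submx_trans (SBi i)) ?(submx_trans (addsmxSl _ _) (addsmxSl _ _)) //=.
  by rewrite -expmxS (submx_trans (addsmxSr _ _) (addsmxSl _ _)).
apply: leq_trans (mxrankS sub) _; apply: leq_trans (mxrank_adds_leqif _ _) _.
by rewrite leq_add2l -rD mxrankM_maxl.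
Qed.

Lemma corank_nilpotent n p (A : 'M[K]_p) : A ^+ n = 0 -> (p <= n * (p - \rank A))%N.
Proof.
move=> An0; have := @codim_nilpotent n p A p 0 An0.
by rewrite mul0mx sub0mx mxrank0 subn0 adds0mx => /(_ isT).
Qed.

(** By the Frobenius inequality the drops [d i - d i.+1] decrease with [i]. Each of the first [m.+1]
    drops is therefore at least the last one, which is [d m]. *)
Lemma rank_free p (A e : 'M[K]_p) m : A *m e = e *m A -> e *m A ^+ m.+1 = 0 ->
  (m.+1 * \rank (e *m A ^+ m) <= \rank e)%N.
Proof.
move=> Ae eA0; pose d i := \rank (e *m A ^+ i).
have drop i : (d i.+1 + d i.+1 <= d i + d i.+2)%N.
  have := mxrank_Frobenius A (e *m A ^+ i) A.
  have -> : A *m (e *m A ^+ i) = e *m A ^+ i.+1 by rewrite mulmxA Ae -mulmxA -expmxS.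
  by rewrite -!mulmxA -!expmxSr.
have dm : d m.+1 = 0%N by rewrite /d eA0 mxrank0.
suff H j : (j <= m)%N ->
    (j.+1 * d m <= d (m - j))%N /\ (d m + d (m - j).+1 <= d (m - j))%N.
  by have [] := H m (leqnn m); rewrite subnn /d expr0 mulmx1.
elim: j => [|j IHj] jm; first by rewrite subn0 dm mul1n addn0.
have [H1 H2] := IHj (ltnW jm).
have e1 : (m - j = (m - j.+1).+1)%N by lia.
by have := drop (m - j.+1)%N; rewrite -!e1 in H1 H2 *; lia.
Qed.

(* The idempotent splits off a maximal free K[x]/(x^(m+1))-summand of the
   module given by A. *)
Lemma free_split m p (A : 'M[K]_p) : A ^+ m.+1 = 0 ->
  exists e : 'M[K]_p,
    [/\ e *m e = e, A *m e = e *m A, e *m A ^+ m = A ^+ m,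
        (m.+1 * \rank (A ^+ m) <= \rank e <= \rank (A ^+ m) + \rank (e *m A))%N
      & (forall k (w : 'M_(k, p)), w *m A ^+ m = 0 -> (w *m e <= A)%MS) /\
        (forall k (y : 'M_(p, k)), A ^+ m *m y = 0 -> ((e *m y)^T <= A^T)%MS)].
Proof.
move=> Am0; set a := \rank (A ^+ m).
pose J := pinvmx (col_base (A ^+ m)) : 'M_(a, p).
pose Y := col_base (A ^+ m) : 'M_(p, a).
have JY : J *m Y = 1%:M by rewrite mulVpmx ?col_base_full.
have JAR : J *m A ^+ m = row_base (A ^+ m).
  by rewrite -[X in J *m X = _](mulmx_base (A ^+ m)) mulmxA JY mul1mx.
have YJA : Y *m (J *m A ^+ m) = A ^+ m by rewrite JAR mulmx_base.
have fJ : row_free (J *m A ^+ m) by rewrite JAR row_base_free.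
(* The rows of [J] generate the free summand, and [L] is a dual family: [J *m A ^+ k *m L] is to be
   the identity for [k = m] and zero otherwise. A right inverse [L0] of [J *m A ^+ m] is corrected
   for [k = m - 1], [m - 2], and so on; the correction made for [m - s.+1] involves [A ^+ s.+1], so
   it does not disturb larger [k]. *)
clearbody J Y; have [L [JL JL0]] : exists L : 'M_(p, a), J *m A ^+ m *m L = 1%:M /\
    forall k, (k < m)%N -> J *m A ^+ k *m L = 0.
  have JAA i j : J *m A ^+ i *m A ^+ j = J *m A ^+ (i + j) by rewrite -mulmxA -expmxD.
  have [L0 JL0] : exists L0, J *m A ^+ m *m L0 = 1%:M by apply/row_freeP.
  suff H s : exists L : 'M_(p, a), J *m A ^+ m *m L = 1%:M /\
      forall k, (k < m)%N -> (m <= k + s)%N -> J *m A ^+ k *m L = 0.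
    by have [L [JL JLs]] := H m; exists L; split=> // k km; apply: JLs; rewrite ?leq_addl.
  elim: s => [|s [L [JL JLs]]].
    by exists L0; split=> // k km; rewrite addn0 leqNgt km.
  have [sm|ms] := ltnP s m; last by exists L; split=> // k km _; apply: JLs => //; lia.
  pose c := J *m A ^+ (m - s.+1) *m L.
  exists (L - A ^+ s.+1 *m L0 *m c); split=> [|k km mk].
    rewrite mulmxBr JL !mulmxA JAA.
    by rewrite (nil_expmx Am0) ?mulmx0 ?mul0mx ?subr0 //; lia.
  rewrite mulmxBr !mulmxA JAA.
  have [->|/eqP nk] := eqVneq k (m - s.+1)%N.
    by rewrite subnK // JL0 mul1mx subrr.
  rewrite [A ^+ (k + _)](nil_expmx Am0) ?mulmx0 ?mul0mx ?subr0; last by lia.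
  by apply: JLs => //; lia.
have JAL k : J *m A ^+ k *m L = if k == m then 1%:M else 0.
  case: ltngtP => [km|mk|->] //; first exact: JL0.
  by rewrite (nil_expmx Am0) // mulmx0 mul0mx.
(* By the duality of [J] and [L] the [E i] are orthogonal idempotents; the image of [E i] lies in
   the span of the rows of [J *m A ^+ (m - i)]. *)
pose E i := A ^+ i *m L *m J *m A ^+ (m - i).
pose e := \sum_(i < m.+1) E i.
have ee : e *m e = e.
  rewrite {1}/e mulmx_suml; apply: eq_bigr => i _; rewrite /e mulmx_sumr.
  have EE j : E i *m E j = A ^+ i *m L *m (J *m A ^+ (m - i + j) *m L) *m (J *m A ^+ (m - j)).
    by rewrite /E expmxD !mulmxA.
  rewrite (bigD1 i) //= big1 ?addr0 => [|j nji].
    by rewrite EE JAL subnK ?eqxx ?mulmx1 ?mulmxA // -ltnS.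
  rewrite EE JAL ifN ?mulmx0 ?mul0mx //.
  have := ltn_ord i; have := ltn_ord j; move: nji; rewrite -val_eqE /=.
  by move=> /eqP nji ? ?; apply/eqP; lia.
have Ae : A *m e = e *m A.
  have AEm : A *m E m = 0 by rewrite /E !mulmxA -expmxS Am0 !mul0mx.
  have E0A : E 0%N *m A = 0 by rewrite /E subn0 -mulmxA -expmxSr Am0 mulmx0.
  have AE i : (i < m)%N -> A *m E i = E i.+1 *m A.
    move=> im; rewrite /E !mulmxA -expmxS -[RHS]mulmxA -expmxSr.
    by congr (_ *m A ^+ _); lia.
  rewrite /e mulmx_sumr mulmx_suml big_ord_recr big_ord_recl /= AEm E0A addr0 add0r.
  by apply: eq_bigr => i _; rewrite AE.
have eAm : e *m A ^+ m = A ^+ m.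
  rewrite /e mulmx_suml big_ord_recr /= /E big1 ?add0r => [|i _].
    rewrite subnn expr0 mulmx1.
    have -> : A ^+ m *m L = Y by rewrite -{1}YJA -mulmxA JL mulmx1.
    by rewrite -mulmxA YJA.
  rewrite -[_ *m A ^+ (m - i) *m _]mulmxA -expmxD.
  by rewrite [A ^+ (m - i + m)](nil_expmx Am0) ?mulmx0 //; have := ltn_ord i; lia.
have eA0 : e *m A ^+ m.+1 = 0 by rewrite Am0 mulmx0.
exists e; split=> //; last split=> [k w wA|k y Ay].
- apply/andP; split; first by rewrite /a -{1}eAm rank_free.
  (* Modulo multiplication by [A], the image of [e] is generated by the [a] rows of [J *m e]. *)
  have sub : (e <= J *m e + e *m A)%MS.
    rewrite -{1}ee {1}/e mulmx_suml summx_sub // => i _; rewrite /E.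
    have [->|im] := eqVneq (i : nat) m.
      rewrite subnn expr0 mulmx1 -mulmxA.
      by rewrite (submx_trans (submxMl _ _)) ?addsmxSl.
    have -> : (m - i = (m - i.+1).+1)%N by have := ltn_ord i; move/eqP: im; lia.
    rewrite expmxSr mulmxA -[_ *m A *m e]mulmxA Ae mulmxA -[_ *m e *m A]mulmxA.
    by rewrite (submx_trans (submxMl _ _)) ?addsmxSr.
  apply: leq_trans (mxrankS sub) (leq_trans (mxrank_adds_leqif _ _) _).
  by rewrite leq_add2r (leq_trans (mxrankM_maxl _ _)) // rank_leq_row.
- rewrite /e mulmx_sumr summx_sub // => i _; rewrite /E !mulmxA.
  have [->|im] := eqVneq (i : nat) m; first by rewrite wA !mul0mx sub0mx.
  have -> : (m - i = (m - i.+1).+1)%N by have := ltn_ord i; move/eqP: im; lia.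
  by rewrite expmxSr mulmxA submxMl.
- rewrite /e mulmx_suml linear_sum summx_sub // => i _; rewrite /E.
  case: i => [[|i] ilt] /=; first by rewrite subn0 -!mulmxA Ay !mulmx0 trmx0 sub0mx.
  by rewrite expmxS -!mulmxA trmx_mul submxMl.
Qed.

End NilpotentMatrices.

(** * Rank inequalities when the image of the source cannot be enlarged *)

Section Unmovable.
Variable K : fieldType.

(* Some p x p matrix with A ^ n = 0 has rank r + 1. *)
Definition nonmax n p r := (p + n <= n * (p - r))%N.

(* The failure of this condition is what allows [improve] to raise the rank of
   A: it provides w with which the image of A can be enlarged. *)
Definition unmovable m p q (A : 'M[K]_p) (B : 'M[K]_q) (g : 'M[K]_(p, q)) :=
  forall w : 'rV_p, w *m A ^+ m = 0 -> (w *m g <= B)%MS -> (w <= A)%MS.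

Lemma rank_quotient a b q (X : 'M[K]_(a, q)) (Q : 'M[K]_(b, q)) :
  (\rank (X *m cokermx Q) + \rank Q <= \rank (X + Q))%N.
Proof.
have e1 := mxrank_mul_ker (X + Q)%MS (cokermx Q).
have l1 : (\rank (X *m cokermx Q) <= \rank ((X + Q)%MS *m cokermx Q))%N.
  by rewrite mxrankS // submxMr // addsmxSl.
have l2 : (\rank Q <= \rank ((X + Q) :&: kermx (cokermx Q)))%N.
  by rewrite mxrankS // sub_capmx addsmxSr; apply/sub_kermxP; rewrite mulmx_coker.
by rewrite -e1 leq_add.
Qed.

Lemma idem_compl p (e : 'M[K]_p) : e *m e = e -> (1%:M - e) *m (1%:M - e) = 1%:M - e.
Proof. by move=> ee; rewrite mulmxBr mulmx1 mulmxBl mul1mx ee subrr subr0. Qed.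

Lemma idem_rank p (e : 'M[K]_p) : e *m e = e -> (\rank (1%:M - e)%R + \rank e = p)%N.
Proof.
move=> ee; rewrite -mxrank_disjoint_sum.
  apply/eqP; rewrite eqn_leq rank_leq_col -{1}(mxrank1 K p) mxrankS //.
  by rewrite -{1}[1%:M](subrK e) addmx_sub_adds.
apply/eqP; rewrite -submx0; apply/rV_subP => w; rewrite sub_capmx.
case/andP => /submxP[x ->] /submxP[y exy].
have : x *m (1%:M - e) *m e = y *m e *m e by rewrite exy.
by rewrite -!mulmxA mulmxBl mul1mx ee subrr mulmx0 -exy => <-; rewrite sub0mx.
Qed.

Lemma idem_factor p (f : 'M[K]_p) : f *m f = f ->
  exists k (i : 'M_(k, p)) (r : 'M_(p, k)), [/\ k = \rank f, i *m r = 1%:M & r *m i = f].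
Proof.
move=> ff; have := col_base_full f; have := row_base_free f; have := mulmx_base f.
move: (row_base f) (col_base f) => i r ri fi fr; exists (\rank f), i, r; split=> //.
apply: (row_full_inj fr); apply: (row_free_inj fi).
by rewrite mulmx1 !mulmxA ri -mulmxA ri.
Qed.

(** A dimension count on the non-free summand [M = 1 - e], which [A ^+ m] kills. The kernel of [g]
    from [M] to the quotient by [Q] lies in [M] intersected with the image of [A], while [M + A]
    contains the kernel of [A ^+ m]. Below, [Q] is [B] or [eps + B]. *)
Lemma unmovable_rank m p q b (A e : 'M[K]_p) (g : 'M[K]_(p, q)) (Q : 'M[K]_(b, q)) :
  A *m e = e *m A -> e *m A ^+ m = A ^+ m ->
  (forall k (w : 'M_(k, p)), w *m A ^+ m = 0 -> (w *m e <= A)%MS) ->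
  (forall w : 'rV_p, w *m A ^+ m = 0 -> (w *m g <= Q)%MS -> (w <= A)%MS) ->
  (p + \rank Q <= \rank A + \rank (A ^+ m) + \rank ((1%:M - e)%R *m g + Q))%N.
Proof.
move=> Ae eAm Ke unm; set M := 1%:M - e.
have MA : M *m A ^+ m = 0 by rewrite mulmxBl mul1mx eAm subrr.
have e1 := mxrank_mul_ker M (g *m cokermx Q).
have e2 := mxrank_sum_cap M A.
have l1 : (\rank (M :&: kermx (g *m cokermx Q)) <= \rank (M :&: A))%N.
  apply: mxrankS; rewrite sub_capmx capmxSl /=; apply/rV_subP => w.
  rewrite sub_capmx => /andP[/submxP[x ->] /sub_kermxP]; rewrite mulmxA => wg.
  by apply: unm; rewrite -?mulmxA ?MA ?mulmx0 // submxE -!mulmxA -wg !mulmxA.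
have l2 : (p - \rank (A ^+ m) <= \rank (M + A))%N.
  rewrite -mxrank_ker mxrankS // -[kermx _]mulmx1 -[1%:M](subrK e) mulmxDr.
  by rewrite addmx_sub_adds ?submxMl // Ke // mulmx_ker.
have l3 := rank_quotient (M *m g) Q; rewrite mulmxA in e1.
have := rank_leq_row (A ^+ m); lia.
Qed.

(** The image [S] under [g] of the non-free part is stable under [B]. [unmovable_rank] bounds
    [\rank (S + B)] below, [codim_nilpotent] bounds the codimension of [S] by that of [S + B], and
    the rest is arithmetic with [m.+1 * \rank (A ^+ m) <= \rank e]. *)
Lemma unmovable_nonmax m p q (A : 'M[K]_p) (B : 'M[K]_q) (g : 'M[K]_(p, q)) :
  A ^+ m.+1 = 0 -> B ^+ m.+1 = 0 -> A *m g = g *m B ->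
  unmovable m A B g -> nonmax m.+1 p (\rank A) -> nonmax m.+1 q (\rank B).
Proof.
move=> A0 B0 AgB unm; rewrite /nonmax => nmA.
have [e [ee Ae eAm /andP[re _] [Ke _]]] := free_split A0.
have r1 := unmovable_rank Ae eAm Ke unm.
set S := (1%:M - e) *m g in r1 *.
have SB : (S *m B <= S)%MS.
  rewrite -mulmxA -AgB mulmxA mulmxBl mul1mx -Ae -[X in X - _]mulmx1 -mulmxBr.
  by rewrite -mulmxA submxMl.
have r2 := codim_nilpotent B0 SB.
have r3 := idem_rank ee.
have r4 : (\rank S <= \rank (1%:M - e)%R)%N by rewrite mxrankM_maxl.
have r5 := rank_leq_row B; have r6 := rank_leq_row A.
move: r1 r2 r3 r4 re nmA r5 r6 (rank_leq_col (S + B)%MS).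
move: (\rank (S + B)) (\rank S) (\rank (1%:M - e)%R).
move: (\rank e) (\rank (A ^+ m)) (\rank A) (\rank B) => x1 x2 x3 x4 y1 y2 y3.
move: m.+1 => n; nia.
Qed.

(** Equality forces [g] to map the non-free part of the source onto the target modulo its free
    summand. The inequality will be combined with its transpose, which is the opposite one, so that
    equality does hold. *)
Lemma rank_sum_eq p q (A : 'M[K]_p) (B : 'M[K]_q) (g : 'M[K]_(p, q))
    (e : 'M[K]_p) (eps : 'M[K]_q) m :
  A ^+ m.+1 = 0 -> B ^+ m.+1 = 0 -> A *m g = g *m B -> unmovable m A B g ->
  A *m e = e *m A -> e *m A ^+ m = A ^+ m ->
  (forall k (w : 'M_(k, p)), w *m A ^+ m = 0 -> (w *m e <= A)%MS) ->
  eps *m eps = eps -> B *m eps = eps *m B -> eps *m B ^+ m = B ^+ m ->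
  (forall k (w : 'M_(k, q)), w *m B ^+ m = 0 -> (w *m eps <= B)%MS) ->
  (p + \rank B + \rank (B ^+ m) <= \rank A + \rank (A ^+ m) + q)%N /\
  ((p + \rank B + \rank (B ^+ m) = \rank A + \rank (A ^+ m) + q)%N ->
    row_full ((1%:M - e)%R *m g + eps)%MS).
Proof.
move=> A0 B0 AgB unm Ae eAm Ke ee Be eBm Keps; set M := 1%:M - e.
(* The hypothesis on [B] extends to [eps + B]: the [eps] component of [w *m g] is killed by
   [B ^+ m], hence lies in the image of [B] already. *)
have unm' (w : 'rV_p) : w *m A ^+ m = 0 -> (w *m g <= eps + B)%MS -> (w <= A)%MS.
  move=> wA wg; apply: unm => //; have /sub_addsmxP[[x y] /= exy] := wg.
  have xe : x *m eps *m B ^+ m = 0.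
    have : w *m g *m B ^+ m = 0 by rewrite -mulmxA -(expmx_intertw m AgB) mulmxA wA mul0mx.
    by rewrite exy mulmxDl -[y *m B *m _]mulmxA -expmxS B0 mulmx0 addr0.
  rewrite exy addmx_sub ?submxMl //.
  by have := Keps _ _ xe; rewrite -mulmxA ee.
have r1 := unmovable_rank Ae eAm Ke unm'; rewrite -/M in r1.
have r2 : (\rank B + \rank (B ^+ m) <= \rank (eps + B))%N.
  have e1 := mxrank_sum_cap eps B; have e2 := mxrank_mul_ker eps (B ^+ m).
  have : (\rank (eps :&: B) <= \rank (eps :&: kermx (B ^+ m)))%N.
    apply: mxrankS; rewrite sub_capmx capmxSl (submx_trans (capmxSr _ _)) //.
    by apply/sub_kermxP; rewrite -expmxS.
  by rewrite eBm in e2; lia.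
have r3 := rank_leq_col (M *m g + (eps + B))%MS.
split=> [|eq_rk]; first by lia.
have full : row_full (M *m g + (eps + B)) by rewrite /row_full; apply/eqP; lia.
set S := (M *m g + eps)%MS.
have SB : (S *m B <= S)%MS.
  rewrite addsmxMr addsmx_sub; apply/andP; split.
    rewrite -mulmxA -AgB mulmxA mulmxBl mul1mx -Ae -[X in X - _]mulmx1 -mulmxBr.
    by rewrite -mulmxA (submx_trans (submxMl _ _)) ?addsmxSl.
  by rewrite -Be (submx_trans (submxMl _ _)) ?addsmxSr.
(* Nakayama: [S + B] is everything, so [S] is. *)
have := codim_nilpotent B0 SB.
have -> : \rank (S + B) = q by move: full; rewrite addsmxA => /eqP.
by rewrite subnn muln0 leqn0 subn_eq0 /row_full eqn_leq rank_leq_col.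
Qed.

(* When neither endomorphism can be improved, g restricts to an isomorphism
   between the non-free parts of the two modules. *)
Lemma unmovable_iso m p q (A : 'M[K]_p) (B : 'M[K]_q) (g : 'M[K]_(p, q)) :
  A ^+ m.+1 = 0 -> B ^+ m.+1 = 0 -> A *m g = g *m B ->
  unmovable m A B g -> unmovable m B^T A^T g^T -> nonmax m.+1 p (\rank A) ->
  exists k (A0 : 'M[K]_k) (i : 'M[K]_(k, p)) (r : 'M[K]_(q, k)),
    [/\ i *m g *m r = 1%:M, i *m A = A0 *m i, B *m r = r *m A0,
        A0 ^+ m = 0 & nonmax m.+1 k (\rank A0)].
Proof.
move=> A0 B0 AgB unA unB nmA.
have [e [ee Ae eAm /andP[re1 re2] [Ke Ke']]] := free_split A0.
have [f [ff Bf fBm _ [Kf Kf']]] := free_split B0.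
have comT p' (C h : 'M[K]_p') : C *m h = h *m C -> C^T *m h^T = h^T *m C^T.
  by move=> Ch; rewrite -!trmx_mul Ch.
have comX p' (C h : 'M[K]_p') :
    C *m h = h *m C -> h *m C ^+ m = C ^+ m -> h^T *m C^T ^+ m = C^T ^+ m.
  move=> Ch hC; rewrite -tr_expmx -trmx_mul; congr trmx; rewrite -{2}hC.
  exact: expmx_intertw.
have KT p' (C h : 'M[K]_p') :
    (forall k (y : 'M_(p', k)), C ^+ m *m y = 0 -> ((h *m y)^T <= C^T)%MS) ->
    forall k (w : 'M_(k, p')), w *m C^T ^+ m = 0 -> (w *m h^T <= C^T)%MS.
  move=> Kh k w wC; have := Kh k w^T; rewrite trmx_mul trmxK; apply.
  by apply: trmx_inj; rewrite trmx_mul trmxK tr_expmx wC trmx0.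
have [le1 full1] := rank_sum_eq A0 B0 AgB unA Ae eAm Ke ff Bf fBm Kf.
have A0T : A^T ^+ m.+1 = 0 by rewrite -tr_expmx A0 trmx0.
have B0T : B^T ^+ m.+1 = 0 by rewrite -tr_expmx B0 trmx0.
have AgBT : B^T *m g^T = g^T *m A^T by rewrite -!trmx_mul AgB.
have eeT : e^T *m e^T = e^T by rewrite -trmx_mul ee.
have [le2 full2] := rank_sum_eq B0T A0T AgBT unB (comT _ _ _ Bf) (comX _ _ _ Bf fBm)
  (KT _ _ _ Kf') eeT (comT _ _ _ Ae) (comX _ _ _ Ae eAm) (KT _ _ _ Ke').
rewrite -!tr_expmx !mxrank_tr in le2 full2.
(* [le1] and [le2] are opposite inequalities, so both are equalities. *)
have /full1 {}full1 : (p + \rank B + \rank (B ^+ m) = \rank A + \rank (A ^+ m) + q)%N.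
  by lia.
have /full2 {}full2 : (q + \rank A + \rank (A ^+ m) = \rank B + \rank (B ^+ m) + p)%N.
  by lia.
have [k [i [r [ek ir ri]]]] := idem_factor (idem_compl ee).
have [l [j [s [_ js sj]]]] := idem_factor (idem_compl ff).
have i1e : i *m (1%:M - e) = i by rewrite -ri mulmxA ir mul1mx.
have ie : i *m e = 0.
  by rewrite -i1e -mulmxA mulmxBl mul1mx ee subrr mulmx0.
have f1s : (1%:M - f) *m s = s by rewrite -sj -mulmxA js mulmx1.
have fs : f *m s = 0 by rewrite -f1s mulmxA mulmxBr mulmx1 ff subrr mul0mx.
(* These are [g], [A], [B] restricted and projected to the non-free summands; [full1] will give a
   left inverse of [Th] and [full2] a right inverse. *)
pose Th := i *m g *m s; pose A' := i *m A *m r; pose B' := j *m B *m s.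
have Am : (1%:M - e) *m A = A *m (1%:M - e) by rewrite mulmxBl mulmxBr mul1mx mulmx1 Ae.
have Bm : (1%:M - f) *m B = B *m (1%:M - f) by rewrite mulmxBl mulmxBr mul1mx mulmx1 Bf.
have iA : i *m A = A' *m i by rewrite /A' -mulmxA ri -mulmxA -Am mulmxA i1e.
have Bs : B *m s = s *m B' by rewrite /B' !mulmxA sj Bm -mulmxA f1s.
have ThB : Th *m B' = A' *m Th.
  by rewrite /Th -mulmxA -Bs mulmxA -[i *m g *m B]mulmxA -AgB mulmxA iA !mulmxA.
have [b bTh] : exists b, b *m Th = 1%:M.
  have /sub_addsmxP[[x y] /= jxy] := submx_full j full1.
  exists (x *m r); rewrite /Th !mulmxA -[x *m r *m i]mulmxA ri.
  by rewrite -js [in RHS]jxy [RHS]mulmxDl -[y *m f *m s]mulmxA fs mulmx0 addr0 !mulmxA.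
have [a Tha] : exists a, Th *m a = 1%:M.
  have /sub_addsmxP[[x y] /= rxy] := submx_full r^T full2.
  have e1 : (1%:M - f^T) *m g^T *m i^T = j^T *m Th^T.
    by rewrite -trmx1 -linearB /= -!trmx_mul -sj /Th !mulmxA.
  have e2 : x *m (j^T *m Th^T) = 1%:M.
    have -> : 1%:M = r^T *m i^T by rewrite -trmx_mul ir trmx1.
    rewrite -e1 [in RHS]rxy [RHS]mulmxDl -[y *m _ *m _]mulmxA -[e^T *m _]trmx_mul ie.
    by rewrite trmx0 mulmx0 addr0 !mulmxA.
  exists (j *m x^T); apply: trmx_inj.
  by rewrite mulmxA trmx_mul trmxK trmx_mul trmx1.
have ab : a = b by rewrite -[a]mul1mx -bTh -mulmxA Tha mulmx1.
exists k, A', i, (s *m a); split=> //.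
- by rewrite mulmxA.
- rewrite mulmxA Bs -[LHS]mulmxA -[RHS]mulmxA; congr (_ *m _).
  have -> : B' *m a = a *m (Th *m B') *m a by rewrite ab mulmxA bTh mul1mx.
  by rewrite ThB -!(mulmxA a) -(mulmxA A') Tha mulmx1.
- have := expmx_intertw m (esym iA); rewrite -eAm mulmxA ie mul0mx => A'i.
  by rewrite -[A' ^+ m]mulmx1 -ir mulmxA A'i mul0mx.
have r0 : (\rank A' <= \rank ((1%:M - e)%R *m A))%N.
  rewrite /A' -{1}i1e -[_ *m _ *m A]mulmxA.
  by rewrite (leq_trans (mxrankM_maxl _ _)) // mxrankM_maxr.
have r1 : (\rank ((1%:M - e)%R *m A) + \rank (e *m A) <= \rank A)%N.
  rewrite -mxrank_disjoint_sum; first by rewrite mxrankS // addsmx_sub !submxMl.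
  apply/eqP; rewrite -submx0; apply/rV_subP => w; rewrite sub_capmx.
  case/andP => /submxP[x ->] /submxP[y exy].
  have : x *m ((1%:M - e) *m A) *m e = y *m (e *m A) *m e by rewrite exy.
  rewrite Am -Ae -!mulmxA mulmxBl mul1mx ee subrr !mulmx0 Ae -exy Am => <-.
  by rewrite sub0mx.
have r2 := idem_rank ee; rewrite -ek in r2.
have r3 := rank_leq_row A; have r4 := rank_leq_row A'.
move: nmA re1 re2 r0 r1 r2 r3 r4; rewrite /nonmax.
move: (\rank A) (\rank A') (\rank e) (\rank (A ^+ m)) (\rank (e *m A)).
move: (\rank ((1%:M - e)%R *m A)) m.+1 => x1 n x2 x3 x4 x5 x6; nia.
Qed.

End Unmovable.

(** * Homomorphisms between modules over K[x]/(x^m) *)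

Section HomVariety.
Variable K : closedFieldType.
Local Notation regmx A := (regmx (fun f => scalar f) A).

Definition triple p q := ('M[K]_p * 'M[K]_q * 'M[K]_(p, q))%type.

(* Matrices act on row vectors here, so P.2 is a homomorphism from the module
   P.1.1 to the module P.1.2. *)
Definition homs m p q (P : triple p q) : Prop :=
  [/\ P.1.1 ^+ m = 0, P.1.2 ^+ m = 0 & P.1.1 *m P.2 = P.2 *m P.1.2].

(** The determinant of [R *m X *m S] is a regular function of [X] that equals 1 at [A]; by
    [det_neq0_rank], [X] has rank at least [\rank A] wherever it does not vanish. Lower bounds on
    ranks thus become open conditions. *)
Lemma rank_certificate a b (A : 'M[K]_(a, b)) :
  exists (R : 'M_(\rank A, a)) (S : 'M_(b, \rank A)), R *m A *m S = 1%:M.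
Proof.
have := row_base_free A; have := col_base_full A; have := mulmx_base A.
move: (col_base A) (row_base A) => C R CR /row_fullP[C' C'C] /row_freeP[R' RR'].
by exists C', R'; rewrite -[X in _ *m X *m _]CR mulmxA C'C mul1mx.
Qed.

Lemma expmxZ p c (A : 'M[K]_p) n : (c *: A) ^+ n = c ^+ n *: A ^+ n.
Proof.
elim: n => [|n IHn]; first by rewrite !expr0 scale1r.
by rewrite !expmxS IHn -scalemxAl -scalemxAr scalerA -exprS.
Qed.

Lemma det_neq0_rank a b r (A : 'M[K]_(a, b)) (R : 'M_(r, a)) (S : 'M_(b, r)) :
  \det (R *m A *m S) != 0 -> (r <= \rank A)%N.
Proof.
rewrite -unitfE -unitmxE -row_free_unit => /eqP <-.
by rewrite (leq_trans (mxrankM_maxl _ _)) // mxrankM_maxr.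
Qed.

Lemma regmx_A p q : regmx (fun P : triple p q => P.1.1).
Proof. by move=> i j; apply: pf_coord => a x y; rewrite !mxE. Qed.

Lemma regmx_B p q : regmx (fun P : triple p q => P.1.2).
Proof. by move=> i j; apply: pf_coord => a x y; rewrite !mxE. Qed.

Lemma regmx_g p q : regmx (fun P : triple p q => P.2).
Proof. by move=> i j; apply: pf_coord => a x y; rewrite !mxE. Qed.

(** * Polynomial parametrization of triples by their restrictions *)

Section Extension.
Variables p' p'' q' q'' : nat.
Local Notation p := (p' + p'')%N.
Local Notation q := (q' + q'')%N.

(** In order: the lower blocks [A''] and [B''], the free parameter [tau] of [g], a candidate [C] for
    a left inverse of [col_mx B' B''], the changes of basis [G] and [H], and the scalars [u], [v]
    that stand for inverse determinants. *)
Definition ext_params :=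
  ('M[K]_(p'', p') * 'M[K]_(q'', q') * 'M[K]_(p'', q) * 'M[K]_(q', q) *
   ('M[K]_p * 'M[K]_q) * (K^o * K^o))%type.

(* The submodule spanned by the first p' basis vectors of the source contains
   the image of x, and is mapped by g into the submodule of the target spanned
   by its first q' basis vectors, which contains the image of x.  Adjugates
   replace inverses so that the parametrization is polynomial. *)
Definition assemble (A' : 'M[K]_p') (B' : 'M[K]_q') (g' : 'M[K]_(p', q'))
    (A'' : 'M[K]_(p'', p')) (B'' : 'M[K]_(q'', q')) (tau : 'M[K]_(p'', q))
    (C : 'M[K]_(q', q)) (G : 'M[K]_p) (H : 'M[K]_q) (u v : K) : triple p q :=
  let Bh := col_mx B' B'' in
  let d := \det (C *m Bh) in
  let W := \adj (C *m Bh) *m C in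
  let g0 := col_mx (d *: row_mx g' 0) (A'' *m g' *m W + tau *m (d%:M - Bh *m W)) in
  ((u * \det H) *: (\adj G *m row_mx (col_mx A' A'') 0 *m G),
   (u * \det G) *: (\adj H *m row_mx Bh 0 *m H),
   v *: (\adj G *m g0 *m H)).

Definition extend (s : triple p' q' * ext_params) : triple p q :=
  assemble s.1.1.1 s.1.1.2 s.1.2 s.2.1.1.1.1.1 s.2.1.1.1.1.2 s.2.1.1.1.2 s.2.1.1.2
    s.2.1.2.1 s.2.1.2.2 s.2.2.1 s.2.2.2.

Lemma assemble_regmap (S : lmodType K) (A' : S -> 'M[K]_p') (B' : S -> 'M[K]_q')
    (g' : S -> 'M[K]_(p', q')) (A'' : S -> 'M[K]_(p'', p')) (B'' : S -> 'M[K]_(q'', q'))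
    (tau : S -> 'M[K]_(p'', q)) (C : S -> 'M[K]_(q', q)) (G : S -> 'M[K]_p)
    (H : S -> 'M[K]_q) (u v : S -> K) :
  regmx A' -> regmx B' -> regmx g' -> regmx A'' -> regmx B'' -> regmx tau ->
  regmx C -> regmx G -> regmx H -> regfun u -> regfun v ->
  regmap (fun s => assemble (A' s) (B' s) (g' s) (A'' s) (B'' s) (tau s) (C s) (G s)
    (H s) (u s) (v s)).
Proof.
move=> rA rB rg rA2 rB2 rt rC rG rH ru rv; rewrite /assemble.
have rBh := regmx_col rB rB2; have rCB := regmx_mul rC rBh; have rd := pf_det rCB.
have rW := regmx_mul (regmx_adj rCB) rC.
have rdM : regmx (fun s => (\det (C s *m col_mx (B' s) (B'' s)))%:M : 'M_q).
  apply: (regmx_ext (A := fun s => \det (C s *m col_mx (B' s) (B'' s)) *: 1%:M)).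
    by move=> s; rewrite scale_scalar_mx mulr1.
  exact: (regmx_scale rd (regmx_const _ _)).
have rg0 := regmx_col (regmx_scale rd (regmx_row rg (regmx_const _ (0 : 'M_(_, q'')))))
  (regmx_add (regmx_mul (regmx_mul rA2 rg) rW)
    (regmx_mul rt (regmx_sub rdM (regmx_mul rBh rW)))).
have rA0 := regmx_row (regmx_col rA rA2) (regmx_const _ (0 : 'M_(_, p''))).
have rB0 := regmx_row rBh (regmx_const _ (0 : 'M_(_, q''))).
have rAG := regmx_adj rG; have rAH := regmx_adj rH.
have dG := pf_mul ru (pf_det rG); have dH := pf_mul ru (pf_det rH).
apply: regmap_pair; first apply: regmap_pair.
- exact: (regmap_mx (regmx_scale dH (regmx_mul (regmx_mul rAG rA0) rG))).
- exact: (regmap_mx (regmx_scale dG (regmx_mul (regmx_mul rAH rB0) rH))).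
- exact: (regmap_mx (regmx_scale rv (regmx_mul (regmx_mul rAG rg0) rH))).
Qed.

Lemma extend_regmap : regmap extend.
Proof.
have r1 : regmap (fun s : triple p' q' * ext_params => s.1) by apply/regmap_fst/regmap_id.
have r2 : regmap (fun s : triple p' q' * ext_params => s.2) by apply/regmap_snd/regmap_id.
have r21 := regmap_fst r2; have r22 := regmap_snd r2.
have r211 := regmap_fst r21; have r2111 := regmap_fst r211; have r21111 := regmap_fst r2111.
apply: assemble_regmap.
- exact/regmx_regmap/regmap_fst/regmap_fst.
- exact/regmx_regmap/regmap_snd/regmap_fst.
- exact/regmx_regmap/regmap_snd.
- exact/regmx_regmap/regmap_fst.
- exact/regmx_regmap/regmap_snd.
- exact/regmx_regmap/regmap_snd.
- exact/regmx_regmap/regmap_snd.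
- exact/regmx_regmap/regmap_fst/regmap_snd.
- exact/regmx_regmap/regmap_snd/regmap_snd.
- exact/regmap_scalar/regmap_fst.
- exact/regmap_scalar/regmap_snd.
Qed.

(** The matrix is a product [X *m Z] through dimension [a], and [Z *m X] is the multiple [T] of
    [A']. Hence its power [k.+1] is [X *m T ^+ k *m Z]: the exponent of nilpotency grows by at most
    one. *)
Lemma extend_nil n a b (A' : 'M[K]_a) (A'' : 'M[K]_(b, a)) (G : 'M[K]_(a + b)) c :
  A' ^+ n = 0 ->
  (c *: (\adj G *m row_mx (col_mx A' A'') 0 *m G)) ^+ n.+1 = 0.
Proof.
move=> A'0; set Y := _ *: _.
have YE : Y = (c *: \adj G) *m (col_mx A' A'' *m row_mx 1%:M 0) *m G.
  by rewrite /Y -!scalemxAl [col_mx _ _ *m row_mx _ _]mul_mx_row mulmx1 mulmx0.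
pose T := \det G *: (c *: A').
have H k : Y ^+ k.+1 = (c *: \adj G) *m col_mx A' A'' *m T ^+ k *m row_mx 1%:M 0 *m G.
  elim: k => [|k IHk]; first by rewrite expr1 YE expr0 mulmx1 !mulmxA.
  have TE : row_mx 1%:M 0 *m G *m (c *: \adj G) *m col_mx A' A'' = T.
    rewrite -[_ *m G *m _]mulmxA -!scalemxAr mul_mx_adj mul_mx_scalar -!scalemxAl mul_row_col.
    by rewrite mul1mx mul0mx addr0 /T !scalerA mulrC.
  rewrite expmxSr IHk YE expmxSr -TE !mulmxA; congr (_ *m _ *m _).
by rewrite H !expmxZ A'0 !scaler0 mulmx0 !mul0mx.
Qed.

(** Valid for all parameters, singular [G], [H] or [C] included, since only [M *m \adj M = \det M]
    is used. The factors [\det H] and [\det G] are placed crosswise in [assemble] so that both sides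
    of the commutation relation acquire the same scalar. *)
Lemma extend_homs m s : homs m s.1 -> homs m.+1 (extend s).
Proof.
case: s => [[[A' B'] g'] [[[[[A'' B''] tau] C] [G H]] [u v]]] [/= A0 B0 AgB].
rewrite /extend /assemble; split=> /=.
- exact: (extend_nil _ _ _ A0).
- exact: (extend_nil _ _ _ B0).
set Bh := col_mx B' B''; set d := \det (C *m Bh);
set W := _ *m C.
set g0 := col_mx (d *: _) _.
have WB : W *m Bh = d%:M by rewrite /W -mulmxA mul_adj_mx.
(* The lower block of [g0] is a particular solution [y] of [y *m Bh = d *: (A'' *m g')] plus [tau]
   times a matrix whose product with [Bh] is zero. *)
have gamBh : (A'' *m g' *m W + tau *m (d%:M - Bh *m W)) *m Bh = d *: (A'' *m g').
  rewrite mulmxDl -[_ *m W *m Bh]mulmxA WB mul_mx_scalar -[tau *m _ *m _]mulmxA mulmxBl.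
  by rewrite -[Bh *m W *m Bh]mulmxA WB scalar_mxC subrr mulmx0 addr0.
have A0g0 : row_mx (col_mx A' A'') 0 *m g0 = g0 *m row_mx Bh 0.
  rewrite mul_row_col mul0mx addr0 [g0 *m _]mul_mx_row mulmx0 [g0 *m Bh]mul_col_mx gamBh.
  rewrite -scalemxAl mul_row_col mul0mx addr0 -AgB -scale_col_mx -mul_col_mx -scalemxAr.
  by rewrite mul_mx_row mulmx0 scale_row_mx scaler0.
rewrite -!scalemxAl -!scalemxAr !scalerA.
have -> : \adj G *m row_mx (col_mx A' A'') 0 *m G *m (\adj G *m g0 *m H) =
    \det G *: (\adj G *m (g0 *m row_mx Bh 0) *m H).
  by rewrite -A0g0 -!mulmxA [G *m _]mulmxA mul_mx_adj mul_scalar_mx -!scalemxAr.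
have -> : \adj G *m g0 *m H *m (\adj H *m row_mx Bh 0 *m H) =
    \det H *: (\adj G *m (g0 *m row_mx Bh 0) *m H).
  by rewrite -!mulmxA [H *m (_ *m _)]mulmxA mul_mx_adj mul_scalar_mx -!scalemxAr.
by rewrite !scalerA; congr (_ *: _); ring.
Qed.

End Extension.

Lemma complete_row_free a b (U : 'M[K]_(a, a + b)) :
  row_free U -> exists Uc : 'M_(b, a + b), col_mx U Uc \in unitmx.
Proof.
move=> fU; have rUc : \rank (U^C)%MS = b.
  by rewrite mxrank_compl (eqP fU) addKn.
have [Uc eUc] : exists Uc : 'M_(b, a + b), (Uc :=: U^C)%MS.
  move: (row_base U^C%MS) (eq_row_base U^C%MS); rewrite rUc => Uc eUc.
  by exists Uc.
exists Uc; rewrite -row_full_unit -sub1mx -addsmxE.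
by rewrite (adds_eqmx (eqmx_refl U) eUc) sub1mx addsmx_compl_full.
Qed.

Lemma adapted_basis a b (A : 'M[K]_(a + b)) (U : 'M_(a, a + b)) :
  row_free U -> (A <= U)%MS ->
  exists G (Ah : 'M_(a + b, a)),
    [/\ G \in unitmx, A = Ah *m U, U = row_mx 1%:M 0 *m G & usubmx G = U].
Proof.
move=> fU /submxP[Ah eA]; have [Uc uG] := complete_row_free fU.
exists (col_mx U Uc), Ah; split=> //; last by rewrite col_mxKu.
by rewrite mul_row_col mul1mx mul0mx addr0.
Qed.

(** In bases of the two spaces extending [U] and a basis [V] of the image of [B], the three matrices
    take the block form of [assemble], and the parameters can be read off. *)
Lemma extend_mem m p' p'' q' q'' (P : triple (p' + p'') (q' + q''))
    (U : 'M_(p', p' + p'')) :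
  homs m.+1 P -> row_free U -> (P.1.1 <= U)%MS -> U *m P.1.1 ^+ m = 0 ->
  (U *m P.2 <= P.1.2)%MS -> \rank P.1.2 = q' ->
  exists2 s : triple p' q' * ext_params p' p'' q' q'', homs m s.1 & P = extend s.
Proof.
case: P => [[A B] g] [/= A0 B0 AgB] fU AU UAm UgB rB.
have [V [fV eV]] : exists V : 'M_(q', q' + q''), row_free V /\ (V :=: B)%MS.
  by move: (row_base B) (row_base_free B) (eq_row_base B); rewrite rB => V; exists V.
have [G [Ah [uG eA eU uGU]]] := adapted_basis fU AU.
have BV : (B <= V)%MS by rewrite eV.
have [H [Bh [uH eB eV1 uHV]]] := adapted_basis fV BV.
have VBm : V *m B ^+ m = 0.
  have /submxP[X ->] : (V <= B)%MS by rewrite eV.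
  by rewrite -mulmxA -expmxS B0 mulmx0.
have /submxP[g' eg'] : (U *m g <= V)%MS by rewrite eV.
(* That [\rank B] is exactly [q'] gives [H *m Bh] full column rank, hence a left inverse. With this
   [C] the determinant [d] in [assemble] is 1. *)
have [C CBh] : exists C, C *m (H *m Bh) = 1%:M.
  apply/row_fullP; rewrite /row_full eqmxMfull ?row_full_unit // eqn_leq rank_leq_col.
  by rewrite -{1}rB eB mxrankM_maxl.
pose gam := G *m g *m invmx H.
have VH : V *m invmx H = row_mx 1%:M 0 by rewrite eV1 mulmxK.
have gamu : usubmx gam = row_mx g' 0.
  rewrite /gam -!mul_usub_mx uGU eg' -mulmxA VH mul_mx_row mulmx1 mulmx0 //.
have key : G *m Ah *m g' = gam *m (H *m Bh).
  have eL : G *m (A *m g) *m invmx H = G *m Ah *m g' *m row_mx 1%:M 0.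
    by rewrite -VH [in LHS]eA !mulmxA -(mulmxA _ U g) eg' !mulmxA.
  have eR : G *m (g *m B) *m invmx H = gam *m (H *m Bh) *m row_mx 1%:M 0.
    by rewrite -VH /gam [in LHS]eB !mulmxA mulmxKV.
  move: eL; rewrite AgB eR !mul_mx_row !mulmx1 !mulmx0.
  by move=> /eq_row_mx[].
pose A' := U *m Ah; pose A'' := dsubmx (G *m Ah).
pose B' := V *m Bh; pose B'' := dsubmx (H *m Bh).
have colA : col_mx A' A'' = G *m Ah by rewrite /A' -uGU mul_usub_mx vsubmxK.
have colB : col_mx B' B'' = H *m Bh by rewrite /B' -uHV mul_usub_mx vsubmxK.
have gamE : gam = col_mx (row_mx g' 0) (dsubmx gam) by rewrite -gamu vsubmxK.
have [key1 key2] : A' *m g' = g' *m B' /\ A'' *m g' = dsubmx gam *m (H *m Bh).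
  move: key; rewrite {1}gamE -colA !mul_col_mx => /eq_col_mx[-> ->].
  by rewrite -{1}colB mul_row_col mul0mx addr0.
have dG : \det G != 0 by rewrite -unitfE -unitmxE.
have dH : \det H != 0 by rewrite -unitfE -unitmxE.
have adjE n (N : 'M[K]_n) : N \in unitmx -> \adj N = \det N *: invmx N.
  move=> uN; rewrite /invmx uN scalerA divff ?scale1r //.
  by rewrite -unitfE -unitmxE.
have row0E a b c (M : 'M[K]_(a, c)) :
    row_mx M (0 : 'M_(a, b)) = M *m row_mx 1%:M 0.
  by rewrite mul_mx_row mulmx1 mulmx0.
(* Taking for [tau] the lower block of [gam] itself works: by [key2] the formula of [assemble] gives
   this block back. *)
exists (A', B', g', (A'', B'', dsubmx gam, C, (G, H), ((\det G * \det H)^-1, (\det G)^-1))).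
  split=> //=.
  - have := @expmx_intertw _ _ _ A' A U m; rewrite /A' -mulmxA -eA UAm => /(_ erefl) e0.
    by apply: (row_free_inj fU); rewrite e0 mul0mx.
  - have := @expmx_intertw _ _ _ B' B V m; rewrite /B' -mulmxA -eB VBm => /(_ erefl) e0.
    by apply: (row_free_inj fV); rewrite e0 mul0mx.
rewrite /extend /assemble /= colA colB CBh det1 adj1 mul1mx scale1r.
rewrite !adjE // -!scalemxAl !scalerA.
have -> : A'' *m g' *m C + dsubmx gam *m (1%:M - H *m Bh *m C) = dsubmx gam.
  by rewrite key2 mulmxBr mulmx1 !mulmxA addrC subrK.
rewrite -gamE; congr (_, _, _).
- have -> : (\det G * \det H)^-1 * \det H * \det G = 1 by field; rewrite dG dH.
  by rewrite scale1r {1}eA {1}eU [row_mx (G *m Ah) 0]row0E !mulmxA mulVmx // mul1mx.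
- have -> : (\det G * \det H)^-1 * \det G * \det H = 1 by field; rewrite dG dH.
  by rewrite scale1r {1}eB {1}eV1 [row_mx (H *m Bh) 0]row0E !mulmxA mulVmx // mul1mx.
- by rewrite mulVf // scale1r /gam !mulmxA mulVmx // mul1mx mulmxKV.
Qed.

End HomVariety.

(** * Deformation to maximal rank, and irreducibility by induction on m *)

Section HomIrreducible.
Variable K : closedFieldType.
Local Notation regmx A := (regmx (fun f => scalar f) A).

(** The witness shifts the basis by [c = p - r] places: its rank is [r], and its [n]-th power shifts
    by [n * c >= p], so it is zero. *)
Lemma nilpotent_of_rank n p r : (r <= p)%N -> (p <= n * (p - r))%N ->
  exists2 A : 'M[K]_p, A ^+ n = 0 & \rank A = r.
Proof.
move=> rp pn; set c := (p - r)%N in pn.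
pose A : 'M[K]_p := \matrix_(i, j) ((j : nat) == (i + c)%N)%:R.
pose U : 'M[K]_(r, p) := \matrix_(i, j) ((j : nat) == (i + c)%N)%:R.
have Apow k (i j : 'I_p) : (j < i + k * c)%N -> (A ^+ k) i j = 0.
  elim: k i j => [|k IHk] i j.
    by rewrite mul0n addn0 expr0 mxE => /ltn_eqF; rewrite eq_sym -val_eqE /= => ->.
  move=> ji; rewrite expmxS mxE big1 // => l _; rewrite [A i l]mxE.
  have [li|_] := eqVneq (l : nat) (i + c)%N; last by rewrite mul0r.
  by rewrite IHk ?mulr0 // li -addnA -mulSn.
have rU : \rank U = r.
  apply/eqP; change (row_free U); apply/row_freeP; exists U^T.
  apply/matrixP => i j; rewrite !mxE.
  have ic : (i + c < p)%N by have := ltn_ord i; rewrite /c; lia.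
  rewrite (bigD1 (Ordinal ic)) //= big1 => [|l nl].
    by rewrite !mxE /= eqxx mul1r addr0 eqn_add2r.
  by rewrite !mxE -(inj_eq val_inj) /= in nl *; rewrite (negbTE nl) mul0r.
exists A.
  apply/matrixP => i j; rewrite Apow ?mxE //.
  by have := ltn_ord j; lia.
apply/eqP; rewrite eqn_leq -rU; apply/andP; split; apply: mxrankS; apply/row_subP => i.
  have [ir|ri] := ltnP i r.
    have -> : row i A = row (Ordinal ir) U by apply/rowP => j; rewrite !mxE.
    exact: row_sub.
  have -> : row i A = 0; last exact: sub0mx.
  apply/rowP => j; rewrite !mxE; case: eqP => // ji.
  by have := ltn_ord j; rewrite ji /c; lia.
have -> : row i U = row (widen_ord rp i) A by apply/rowP => j; rewrite !mxE.
exact: row_sub.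
Qed.

Lemma row_basis p a r (A : 'M[K]_(a, p)) : \rank A = r ->
  exists U : 'M_(r, p), row_free U /\ (U :=: A)%MS.
Proof.
move=> rA; move: (row_base A) (row_base_free A) (eq_row_base A).
by rewrite rA => U; exists U.
Qed.

Lemma pf_rank p q a b r (R : 'M[K]_(r, a)) (S : 'M[K]_(b, r))
    (phi : triple K p q -> 'M_(a, b)) :
  regmx phi -> regfun (fun P => \det (R *m phi P *m S)).
Proof.
by move=> rphi; apply/pf_det/regmx_mul; [apply: regmx_mul => // |]; apply: regmx_const.
Qed.

(* The extensions with image of A inside the span of U form an irreducible
   family; it contains a point with g = 0 whose A has rank p'. *)
Lemma improve_split m p q p' p'' q' q'' (P : triple K p q) (U : 'M_(p', p)) F :
  p = (p' + p'')%N -> q = (q' + q'')%N ->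
  (forall p q, zirr (@homs K m p q)) ->
  homs m.+1 P -> row_free U -> (P.1.1 <= U)%MS -> U *m P.1.1 ^+ m = 0 ->
  (U *m P.2 <= P.1.2)%MS -> \rank P.1.2 = q' ->
  (p' + p'' <= m.+1 * p'')%N -> regfun F -> F P != 0 ->
  exists P' : triple K p q,
    [/\ homs m.+1 P', F P' != 0, (p' <= \rank P'.1.1)%N & (q' <= \rank P'.1.2)%N].
Proof.
move=> ep eq; subst p q => IH hP fU AU UA Ug rB pp pF FP.
have [A1 A10 rA1] : exists2 A1 : 'M[K]_(p' + p''), A1 ^+ m.+1 = 0 & \rank A1 = p'.
  by apply: nilpotent_of_rank; rewrite ?leq_addr ?addKn.
have [U1 [fU1 eU1]] := row_basis rA1.
have hP1 : homs m.+1 ((A1, P.1.2, 0) : triple K _ _).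
  by case: hP => _ B0 _; split=> //=; rewrite mulmx0 mul0mx.
have [s hs eP] := extend_mem hP fU AU UA Ug rB.
have [|||s1 hs1 eP1] := extend_mem hP1 fU1 _ _ _ rB.
- by rewrite /= eU1.
- have /submxP[X ->] : (U1 <= A1)%MS by rewrite eU1.
  by rewrite -mulmxA -expmxS A10 mulmx0.
- by rewrite /= mulmx0 sub0mx.
have iT := zirr_image (zirr_affine (IH p' q')) (@extend_regmap K p' p'' q' q'').
have [R [S RS]] := rank_certificate A1.
have [R' [S' RS']] := rank_certificate P.1.2.
(* The certificate for [B] is multiplied with [F], because [P] satisfies both conditions; the second
   point [(A1, P.1.2, 0)] only has to account for the rank of [A]. *)
have [||P' [hP' ]] := iT _ _ (pf_mul pF (pf_rank R' S' (@regmx_B K _ _)))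
                          (pf_rank R S (@regmx_A K _ _)).
- by exists P; [exists s | rewrite RS' det1 mulr1].
- by exists (A1, P.1.2, 0); [exists s1 | rewrite RS det1 oner_eq0].
rewrite mulf_eq0 negb_or => /andP[FP' rB'] rA'.
case: hP' => t ht eP'; exists P'; split=> //.
- by rewrite eP'; apply: extend_homs.
- by have := det_neq0_rank rA'; rewrite rA1.
- by have := det_neq0_rank rB'; rewrite rB.
Qed.

(** [improve_split] is applied with [U] the image of [A] enlarged by [w], of dimension one more than
    [\rank P.1.1]. *)
Lemma improve m p q (P : triple K p q) (w : 'rV_p) F :
  (forall p q, zirr (@homs K m p q)) ->
  homs m.+1 P -> regfun F -> F P != 0 -> nonmax m.+1 p (\rank P.1.1) ->
  w *m P.1.1 ^+ m = 0 -> ~~ (w <= P.1.1)%MS -> (w *m P.2 <= P.1.2)%MS ->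
  exists P' : triple K p q,
    [/\ homs m.+1 P', F P' != 0, (\rank P.1.1 < \rank P'.1.1)%N &
      (\rank P.1.2 <= \rank P'.1.2)%N].
Proof.
move=> IH hP pF FP nm wA nwA wg.
have rU : \rank (P.1.1 + w)%MS = (\rank P.1.1).+1.
  apply/eqP; rewrite eqn_leq; apply/andP; split.
    by have [le _] := mxrank_adds_leqif P.1.1 w; have := rank_leq_row w; lia.
  rewrite ltn_neqAle mxrankS ?addsmxSl // andbT.
  by rewrite (mxrank_leqif_sup (addsmxSl _ _)) addsmx_sub submx_refl.
have [U [fU eU]] := row_basis rU.
have [p'' ep] : exists p'', p = ((\rank P.1.1).+1 + p'')%N.
  by exists (p - (\rank P.1.1).+1)%N; rewrite subnKC // -(eqP fU) rank_leq_col.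
have [q'' eq] : exists q'', q = (\rank P.1.2 + q'')%N.
  by exists (q - \rank P.1.2)%N; rewrite subnKC // rank_leq_col.
have AU : (P.1.1 <= U)%MS by rewrite eU addsmxSl.
have UA : U *m P.1.1 ^+ m = 0.
  have /sub_addsmxP[[x y] /= ->] : (U <= P.1.1 + w)%MS by rewrite eU.
  by case: hP => A0 _ _; rewrite mulmxDl -!mulmxA wA -expmxS A0 !mulmx0 addr0.
have Ug : (U *m P.2 <= P.1.2)%MS.
  have /sub_addsmxP[[x y] /= ->] : (U <= P.1.1 + w)%MS by rewrite eU.
  case: hP => _ _ AgB; rewrite mulmxDl -!mulmxA AgB addmx_sub //.
    by rewrite mulmxA submxMl.
  by rewrite (submx_trans (submxMl _ _)).
apply: (improve_split ep eq IH hP fU AU UA Ug (erefl _) _ pF FP).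
by move: nm; rewrite /nonmax; move: (\rank P.1.1) ep => r ->; nia.
Qed.

(** Vector space duality: it exchanges source and target, and thereby images and kernels. *)
Definition tr_triple p q (P : triple K p q) : triple K q p := (P.1.2^T, P.1.1^T, P.2^T).

Lemma tr_triple_regmap p q : regmap (@tr_triple p q).
Proof.
apply: regmap_pair; first apply: regmap_pair.
- exact/regmap_mx/regmx_tr/regmx_B.
- exact/regmap_mx/regmx_tr/regmx_A.
- exact/regmap_mx/regmx_tr/regmx_g.
Qed.

Lemma tr_triple_homs m p q (P : triple K p q) : homs m P -> homs m (tr_triple P).
Proof.
case=> A0 B0 AgB; split=> /=; rewrite -?tr_expmx ?A0 ?B0 ?trmx0 //.
by rewrite -!trmx_mul AgB.
Qed.

Lemma tr_tripleK p q : cancel (@tr_triple p q) (@tr_triple q p).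
Proof. by case=> [[A B] g]; rewrite /tr_triple /= !trmxK. Qed.

Lemma unmovableP m p q (A : 'M[K]_p) (B : 'M[K]_q) (g : 'M[K]_(p, q)) :
  unmovable m A B g \/
  exists w : 'rV_p, [/\ w *m A ^+ m = 0, (w *m g <= B)%MS & ~~ (w <= A)%MS].
Proof.
pose Ker := (kermx (A ^+ m) :&: kermx (g *m cokermx B))%MS.
have [sub|/row_subPn[i ni]] := boolP (Ker <= A)%MS.
  left=> w wA wg; apply: submx_trans sub; rewrite sub_capmx.
  by apply/andP; split; apply/sub_kermxP => //; apply/eqP; rewrite mulmxA -submxE.
right; exists (row i Ker); have := row_sub i Ker; rewrite {1}/Ker sub_capmx.
case/andP => /sub_kermxP h1 /sub_kermxP h2; split=> //.
by rewrite submxE -mulmxA h2.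
Qed.

(** The maps [i] and [r] exhibit [A0] as a direct summand of [A], with complementary part [A1].
    Replacing the block [A0] by [U] changes powers and ranks blockwise. *)
Lemma summand_deform m p k (A : 'M[K]_p) (A0 U : 'M[K]_k) (i : 'M_(k, p)) (r : 'M_(p, k)) :
  i *m r = 1%:M -> i *m A = A0 *m i -> A *m r = r *m A0 ->
  A ^+ m.+1 = 0 -> U ^+ m.+1 = 0 ->
  (A + r *m (U - A0) *m i) ^+ m.+1 = 0 /\
  (\rank (A + r *m (U - A0) *m i)%R + \rank A0 = \rank A + \rank U)%N.
Proof.
move=> ir iA Ar Am Um; pose A1 := A - r *m A0 *m i.
have A1r : A1 *m r = 0 by rewrite mulmxBl Ar -[_ *m i *m r]mulmxA ir mulmx1 subrr.
have iA1 : i *m A1 = 0 by rewrite mulmxBr iA !mulmxA ir mul1mx subrr.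
have AE : A = A1 + r *m A0 *m i by rewrite subrK.
clearbody A1; have powE n V : (A1 + r *m V *m i) ^+ n.+1 = A1 ^+ n.+1 + r *m V ^+ n.+1 *m i.
  elim: n => [|n IHn]; first by rewrite !expr1.
  rewrite expmxSr IHn mulmxDl !mulmxDr -!expmxSr.
  have -> : A1 ^+ n.+1 *m (r *m V *m i) = 0.
    by rewrite expmxSr !mulmxA -[_ *m A1 *m r]mulmxA A1r mulmx0 !mul0mx.
  have -> : r *m V ^+ n.+1 *m i *m A1 = 0 by rewrite -mulmxA iA1 mulmx0.
  rewrite addr0 add0r [V ^+ n.+2]expmxSr !mulmxA; congr (_ + _ *m _).
  by rewrite -[_ *m i *m r]mulmxA ir mulmx1.
have rankE V : (\rank (A1 + r *m V *m i)%R = \rank A1 + \rank V)%N.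
  have rV : \rank (r *m V *m i) = \rank V.
    apply/eqP; rewrite eqn_leq; apply/andP; split.
      by rewrite (leq_trans (mxrankM_maxl _ _)) // mxrankM_maxr.
    have -> : \rank V = \rank (i *m (r *m V *m i) *m r).
      by rewrite !mulmxA ir mul1mx -mulmxA ir mulmx1.
    by rewrite (leq_trans (mxrankM_maxl _ _)) // mxrankM_maxr.
  rewrite -{1}rV -mxrank_disjoint_sum; last first.
    apply/eqP; rewrite -submx0; apply/rV_subP => w; rewrite sub_capmx.
    case/andP => /submxP[x ->] /submxP[y exy].
    have : x *m A1 *m r = y *m (r *m V *m i) *m r by rewrite exy.
    rewrite -mulmxA A1r mulmx0 -!mulmxA ir mulmx1 => h.
    by rewrite exy !mulmxA -[y *m r *m V]mulmxA -h mul0mx sub0mx.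
  apply/eqmx_rank/andP; split; first exact: addmx_sub_adds.
  rewrite addsmx_sub; apply/andP; split.
    have {1}-> : A1 = (1%:M - r *m i) *m (A1 + r *m V *m i); last exact: submxMl.
    rewrite mulmxDr !mulmxBl !mul1mx -[r *m i *m A1]mulmxA iA1 mulmx0 subr0.
    by rewrite !mulmxA -[r *m i *m r]mulmxA ir mulmx1 subrr addr0.
  have {1}-> : r *m V *m i = r *m i *m (A1 + r *m V *m i); last exact: submxMl.
  rewrite mulmxDr -[r *m i *m A1]mulmxA iA1 mulmx0 add0r.
  by rewrite !mulmxA -[r *m i *m r]mulmxA ir mulmx1.
have A0m : A0 ^+ m.+1 = 0.
  have := expmx_intertw m.+1 (esym iA); rewrite Am mulmx0 => A0i.
  by rewrite -[A0 ^+ _]mulmx1 -ir mulmxA A0i mul0mx.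
have A1m : A1 ^+ m.+1 = 0.
  by have := powE m A0; rewrite -AE Am A0m mulmx0 mul0mx addr0.
have -> : A + r *m (U - A0) *m i = A1 + r *m U *m i.
  by rewrite {1}AE mulmxBr mulmxBl addrC -addrA [- _ + _]addrC addrK addrC.
by rewrite powE A1m Um mulmx0 mul0mx addr0 AE !rankE; split=> //; lia.
Qed.

(** If the image of the source cannot be enlarged, the target is not maximal either, by
    [unmovable_nonmax], and the dual move is tried. If that fails too, [unmovable_iso] provides a
    common summand [C] to deform on both sides. *)
Lemma improve_source m p q (P : triple K p q) F :
  (forall p q, zirr (@homs K m p q)) ->
  homs m.+1 P -> regfun F -> F P != 0 -> nonmax m.+1 p (\rank P.1.1) ->
  exists P' : triple K p q,
    [/\ homs m.+1 P', F P' != 0 &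
      (\rank P.1.1 + \rank P.1.2 < \rank P'.1.1 + \rank P'.1.2)%N].
Proof.
move=> IH hP pF FP nm; have [A0 B0 AgB] := hP.
have [unA|[w [wA wg nwA]]] := unmovableP m P.1.1 P.1.2 P.2; last first.
  have [P' [? ? ? ?]] := improve IH hP pF FP nm wA nwA wg.
  by exists P'; split=> //; lia.
have nmB := unmovable_nonmax A0 B0 AgB unA nm.
have [unB|[w [wA wg nwA]]] := unmovableP m P.1.2^T P.1.1^T P.2^T; last first.
  have pF' : regfun (F \o @tr_triple q p) by apply: regfun_comp pF (@tr_triple_regmap _ _).
  have [|||P' [h1 h2 h3 h4]] := improve IH (tr_triple_homs hP) pF' _ _ _ nwA wg.
  - by rewrite /= tr_tripleK.
  - by rewrite /= mxrank_tr.
  - exact: wA.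
  exists (tr_triple P'); split=> //; first exact: tr_triple_homs.
  by move: h3 h4; rewrite /= !mxrank_tr; lia.
have [k [C [i [r [igr iA Br C0 nmC]]]]] := unmovable_iso A0 B0 AgB unA unB nm.
(* [phi] replaces the common summand [C] by [Q.1.1] on both sides and keeps [g]; the commutation
   relation is preserved for every [Q]. The target dimension 0 makes [improve] a statement about the
   single matrix [C]. *)
pose phi (Q : triple K k 0) : triple K p q :=
  (P.1.1 + P.2 *m r *m (Q.1.1 - C) *m i, P.1.2 + r *m (Q.1.1 - C) *m (i *m P.2), P.2).
have rphi : regmap phi.
  have rd : regmx (fun Q : triple K k 0 => Q.1.1 - C).
    by apply: regmx_sub; [apply: regmx_A | apply: regmx_const].
  apply: regmap_pair; last by apply/regmap_mx/regmx_const.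
  apply: regmap_pair; apply/regmap_mx/regmx_add; try exact: regmx_const;
    by apply: regmx_mul; [apply: regmx_mul => // |]; apply: regmx_const.
pose Q0 : triple K k 0 := (C, 0, 0).
have hQ0 : homs m.+1 Q0.
  split=> /=; first by rewrite expmxS C0 mulmx0.
    by apply/matrixP => -[].
  by rewrite mulmx0 mul0mx.
have [w nwC] : exists w : 'rV_k, ~~ (w <= C)%MS.
  have /row_subPn[j nj] : ~~ (1%:M <= C)%MS.
    rewrite sub1mx /row_full; apply/eqP => rC; move: nmC.
    by rewrite /nonmax rC subnn muln0 addnS.
  by exists (row j 1%:M).
have FQ0 : (F \o phi) Q0 != 0.
  by rewrite /= /phi /= subrr !mulmx0 !mul0mx !addr0; move: FP; case: (P) => -[].
(* As [C ^+ m = 0] and the map to the zero target vanishes, any [w] outside the image of [C] is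
   admissible. *)
have [||Q [hQ FQ ltQ _]] := improve IH hQ0 (regfun_comp pF rphi) FQ0 nmC _ nwC.
- by rewrite /= C0 mulmx0.
- by rewrite mulmx0 sub0mx.
have [U0 _ _] := hQ.
have [||||| An Ar] := @summand_deform m p k P.1.1 C Q.1.1 i (P.2 *m r).
- by rewrite mulmxA.
- exact: iA.
- by rewrite mulmxA AgB -!mulmxA Br.
- exact: A0.
- exact: U0.
have [||||| Bn Brk] := @summand_deform m q k P.1.2 C Q.1.1 (i *m P.2) r.
- exact: igr.
- by rewrite -mulmxA -AgB !mulmxA iA.
- exact: Br.
- exact: B0.
- exact: U0.
exists (phi Q); split=> //.
  by split=> //=; rewrite mulmxDl [RHS]mulmxDr AgB !mulmxA.
rewrite -(ltn_add2r (\rank C + \rank C)) /= addnACA [X in (_ < X)%N]addnACA Ar Brk.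
by move: ltQ; rewrite /Q0 /= => ltQ; rewrite -addSn leq_add // ?ltn_add2l // leq_add2l ltnW.
Qed.

Lemma improve_any m p q (P : triple K p q) F :
  (forall p q, zirr (@homs K m p q)) ->
  homs m.+1 P -> regfun F -> F P != 0 ->
  nonmax m.+1 p (\rank P.1.1) || nonmax m.+1 q (\rank P.1.2) ->
  exists P' : triple K p q,
    [/\ homs m.+1 P', F P' != 0 &
      (\rank P.1.1 + \rank P.1.2 < \rank P'.1.1 + \rank P'.1.2)%N].
Proof.
move=> IH hP pF FP /orP[nm|nm]; first exact: improve_source.
have pF' : regfun (F \o @tr_triple q p) by apply: regfun_comp pF (@tr_triple_regmap _ _).
have [||P' [h1 h2 h3]] := improve_source IH (tr_triple_homs hP) pF'.
- by rewrite /= tr_tripleK.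
- by rewrite /= mxrank_tr.
exists (tr_triple P'); split=> //; first exact: tr_triple_homs.
by move: h3; rewrite /= !mxrank_tr; lia.
Qed.

Lemma maximize m p q (P : triple K p q) F :
  (forall p q, zirr (@homs K m p q)) -> homs m.+1 P -> regfun F -> F P != 0 ->
  exists P' : triple K p q,
    [/\ homs m.+1 P', F P' != 0, ~~ nonmax m.+1 p (\rank P'.1.1) &
      ~~ nonmax m.+1 q (\rank P'.1.2)].
Proof.
move=> IH hP pF FP; have [n] := ubnP (p + q - (\rank P.1.1 + \rank P.1.2)).
elim: n P hP FP => // n IHn P hP FP ltn.
have [nm|] := boolP (nonmax m.+1 p (\rank P.1.1) || nonmax m.+1 q (\rank P.1.2)); last first.
  by rewrite negb_or => /andP[? ?]; exists P.
have [P' [hP' FP' lt]] := improve_any IH hP pF FP nm.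
apply: (IHn P') => //.
by have := rank_leq_row P'.1.1; have := rank_leq_row P'.1.2; lia.
Qed.

(** Both coranks are the least integer that is at least [p / m.+1]: [corank_nilpotent] is the lower
    bound, failure of [nonmax] the upper one. *)
Lemma max_rank_unique m p (A A' : 'M[K]_p) : A ^+ m.+1 = 0 -> A' ^+ m.+1 = 0 ->
  ~~ nonmax m.+1 p (\rank A) -> ~~ nonmax m.+1 p (\rank A') -> \rank A = \rank A'.
Proof.
move=> /corank_nilpotent h /corank_nilpotent h'; rewrite /nonmax -!ltnNge.
move: (rank_leq_row A) (rank_leq_row A') h h'; move: (\rank A) (\rank A') => x y.
by move: m.+1 => n; nia.
Qed.

(** With [U] the image of [A], every triple with these ranks is an extension of a triple for [m] in
    dimensions [p'], [q'], and the extensions form an irreducible family inside [homs m.+1]. *)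
Lemma zirr_extend m p q p' p'' q' q'' :
  p = (p' + p'')%N -> q = (q' + q'')%N -> (forall p q, zirr (@homs K m p q)) ->
  forall F1 F2, regfun F1 -> regfun F2 ->
    (exists2 P : triple K p q,
      [/\ homs m.+1 P, \rank P.1.1 = p' & \rank P.1.2 = q'] & F1 P != 0) ->
    (exists2 P : triple K p q,
      [/\ homs m.+1 P, \rank P.1.1 = p' & \rank P.1.2 = q'] & F2 P != 0) ->
    exists P, [/\ homs m.+1 P, F1 P != 0 & F2 P != 0].
Proof.
move=> ep eq IH F1 F2 pF1 pF2 [P1 [h1 rA1 rB1] n1] [P2 [h2 rA2 rB2] n2]; subst p q.
have mem (P : triple K (p' + p'') (q' + q'')) : homs m.+1 P -> \rank P.1.1 = p' ->
    \rank P.1.2 = q' ->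
    exists2 s : triple K p' q' * ext_params K p' p'' q' q'', homs m s.1 & P = extend s.
  move=> hP rA rB; have [U [fU eU]] := row_basis rA; have [A0 B0 AgB] := hP.
  have /submxP[X eX] : (U <= P.1.1)%MS by rewrite eU.
  apply: (extend_mem hP fU) => //; first by rewrite eU.
    by rewrite eX -mulmxA -expmxS A0 mulmx0.
  by rewrite eX -mulmxA AgB mulmxA submxMl.
have [||_ [[s hs ->] m1 m2]] := zirr_image (zirr_affine (IH p' q'))
  (@extend_regmap K p' p'' q' q'') pF1 pF2.
- by exists P1 => //; apply: mem.
- by exists P2 => //; apply: mem.
by exists (extend s); split=> //; apply: extend_homs.
Qed.

Theorem homs_irreducible m p q : zirr (@homs K m p q).
Proof.
elim: m p q => [|m IH] p q F1 F2 pF1 pF2.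
  (* For exponent 0 the condition reads [1 = 0], so both dimensions are zero and there is only one
     triple. *)
  move=> [[[A B] g] hP n1] [[[A' B'] g'] hP' n2]; exists (A, B, g); split=> //.
  case: hP => /= h1 h2 _; have p0 n (N : 'M[K]_n) : N ^+ 0 = 0 -> n = 0%N.
    case: n N => // n N; rewrite expr0 => /matrixP/(_ ord0 ord0).
    by rewrite !mxE => /eqP; rewrite oner_eq0.
  have e1 := p0 _ _ h1; have e2 := p0 _ _ h2; subst p q.
  rewrite (flatmx0 A) (flatmx0 B) (flatmx0 g).
  by move: n2; rewrite (flatmx0 A') (flatmx0 B') (flatmx0 g').
move=> [P1 hP1 n1] [P2 hP2 n2].
(* Both points move to maximal ranks while [F1], respectively [F2], stays nonzero; maximal ranks
   being unique, they end in the same irreducible family. *)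
have [P1' [h1 m1 a1 b1]] := maximize IH hP1 pF1 n1.
have [P2' [h2 m2 a2 b2]] := maximize IH hP2 pF2 n2.
have [A1 B1 _] := h1; have [A2 B2 _] := h2.
have rA := max_rank_unique A1 A2 a1 a2; have rB := max_rank_unique B1 B2 b1 b2.
have [p'' ep] : exists p'', p = (\rank P1'.1.1 + p'')%N.
  by exists (p - \rank P1'.1.1)%N; rewrite subnKC // rank_leq_row.
have [q'' eq] : exists q'', q = (\rank P1'.1.2 + q'')%N.
  by exists (q - \rank P1'.1.2)%N; rewrite subnKC // rank_leq_row.
have [||Q [hQ f1 f2]] := @zirr_extend m p q _ p'' _ q'' ep eq IH _ _ pF1 pF2.
- by exists P1'.
- by exists P2'; rewrite -?rA -?rB.
by exists Q.
Qed.

End HomIrreducible.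

(** * The quiver with one loop *)

(** A closed set not containing [Y] has a defining polynomial that is nonzero at some point of [Y].
    Two such polynomials, pulled back along [phi], would be nonzero at a common point of [X], which
    no covering by the two closed sets allows. *)
Lemma zirreducible_image (K : closedFieldType) (U : lmodType K) (X : U -> Prop)
    (T : Type) (coord : (T -> K) -> Prop) (phi : U -> T) (Y : T -> Prop) :
  zirr X -> (exists u, X u) -> (forall f, coord f -> regfun (f \o phi)) ->
  (forall u, X u -> Y (phi u)) -> (forall y, Y y -> exists2 u, X u & y = phi u) ->
  zirreducible coord Y.
Proof.
move=> iX [u0 Xu0] rphi XY YX; split; first by exists (phi u0); apply: XY.
have pphi F : polyfun coord F -> regfun (F \o phi).
  elim=> [c|f /rphi //|f g _ h1 _ h2|f g _ h1 _ h2].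
  - exact: pf_const.
  - exact: pf_add h1 h2.
  - exact: pf_mul h1 h2.
have sep Z : zclosed coord Z -> ~ (forall x, Y x -> Z x) ->
    exists F, [/\ polyfun coord F, forall x, Z x -> F x = 0 & exists2 u, X u & F (phi u) != 0].
  move=> [FF [pFF ZFF]] /not_all_ex_not[y nYZ].
  have [Yy nZy] : Y y /\ ~ Z y by split; [apply: NNPP => nY | move=> Zy]; apply: nYZ => // /nY.
  have /not_all_ex_not[F nF] : ~ (forall f, FF f -> f y = 0) by move/ZFF.
  have [FFF Fy] : FF F /\ F y <> 0.
    by split; [apply: NNPP => nFF | move=> Fy]; apply: nF => // /nFF.
  exists F; split; [exact: pFF | by move=> x /ZFF; apply |].
  by have [u Xu ey] := YX y Yy; exists u; rewrite // -ey; apply/eqP.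
move=> Z1 Z2 cZ1 cZ2 cover; apply: NNPP => /not_or_and[/(sep _ cZ1)].
case=> F1 [pF1 zF1 [u1 Xu1 n1]] /(sep _ cZ2)[F2 [pF2 zF2 [u2 Xu2 n2]]].
have [||u [Xu /eqP m1 /eqP m2]] := iX _ _ (pphi _ pF1) (pphi _ pF2).
- by exists u1.
- by exists u2.
by case: (cover _ (XY _ Xu)) => [/zF1 | /zF2].
Qed.

Lemma conform_mx0 (R : nzRingType) a b a' b' :
  conform_mx (0 : 'M[R]_(a', b')) (0 : 'M_(a, b)) = 0.
Proof.
apply/matrixP => i j; rewrite /conform_mx.
by case: eqP => // ?; case: eqP => // ?; rewrite castmxE !mxE.
Qed.

Lemma conform_mulmx (R : nzRingType) a b c a' b' c' (A : 'M[R]_(a, b)) (B : 'M[R]_(b, c)) :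
  a = a' -> b = b' -> c = c' ->
  conform_mx (0 : 'M_(a', c')) (A *m B) =
    conform_mx (0 : 'M_(a', b')) A *m conform_mx (0 : 'M_(b', c')) B.
Proof. by move=> ea eb ec; subst a' b' c'; rewrite !conform_mx_id. Qed.

Section LoopWords.
Variables (K : fieldType) (L : bquiver K) (d : vert (bq L) -> nat) (V : qrep d).
Variable x : vert (bq L).

(** A cast to a square matrix type, intended for loops at [x]; when the dimensions do not fit, the
    default value is 0. *)
Definition loop_mx (a : arr (bq L)) : 'M[K]_(d x) := conform_mx 0 (V a).

Fixpoint loop_word (w : seq (arr (bq L))) : 'M[K]_(d x) :=
  if w is a :: w' then loop_word w' *m loop_mx a else 1%:M.

Lemma endpt_loops y w : y = x -> all (fun a => tgt a == x) w -> endpt y w = x.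
Proof. by elim: w y => //= a w IHw y _ /andP[/eqP ta]; apply: IHw. Qed.

Lemma pev_loops y w : y = x -> all (fun a => (src a == x) && (tgt a == x)) w ->
  conform_mx (0 : 'M_(d x)) (pev V y w) = loop_word w.
Proof.
elim: w y => [|a w IHw] y ->; first by rewrite /= conform_mx_id.
case/andP => /andP[/eqP sa /eqP ta] aw; rewrite /= (@conform_mulmx _ _ _ _ _ (d x) (d x)).
- rewrite (IHw _ ta aw); congr (_ *m _); rewrite /loop_mx.
  move: (V a); rewrite sa ta => M; by rewrite !conform_mx_id.
- rewrite endpt_loops //; apply: sub_all aw => b /andP[_ ->] //.
- by rewrite ta.
- by [].
Qed.

End LoopWords.

Section LoopQuiver.
Variables (K : fieldType) (m : nat).

(* For m = 1 the loop would generate a relation of length 1, so there is no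
   loop at all. *)
Definition loop_quiver : quiver :=
  @Quiver unit 'I_(1 < m)%N (fun=> tt) (fun=> tt).

Local Notation arrow := 'I_(1 < m)%N.

Definition loop_rels (r : qrel loop_quiver K) : Prop :=
  exists a : arrow, r = @QRel loop_quiver K tt tt [:: (1, nseq m a)].

Lemma arrow_eq (a a' : arrow) : a = a'.
Proof.
have le1 : ((1 < m)%N <= 1)%N by case: (1 < m)%N.
by apply: ord_inj; have := ltn_ord a; have := ltn_ord a'; lia.
Qed.

Lemma arrow_gt1 (a : arrow) : (1 < m)%N.
Proof. by have := leq_ltn_trans (leq0n a) (ltn_ord a); case: (1 < m)%N. Qed.

Lemma word_eq (w w' : seq arrow) : size w = size w' -> w = w'.
Proof. by elim: w w' => [|a w IHw] [|a' w'] //= [/IHw ->]; rewrite (arrow_eq a a'). Qed.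

Lemma loop_valid x (w : seq arrow) : @valid_from loop_quiver x w.
Proof. by elim: w x => //= a w IHw []. Qed.

Lemma loop_rels_wf r : loop_rels r -> rel_wf r.
Proof. by case=> a ->; rewrite /rel_wf /= loop_valid size_nseq (arrow_gt1 a). Qed.

(** There is at most one word of each length, so the path algebra is read as polynomials in the
    loop; this is the coefficient in degree [k]. *)
Definition deg_coeff (u : kQ loop_quiver K) (k : nat) : K :=
  \sum_(c <- u | size c.2.2 == k) c.1.

Lemma coeff_deg u (q : qpath loop_quiver) : coeff u q = deg_coeff u (size q.2).
Proof.
case: q => -[] w; apply: eq_bigl => -[c [[] w']]; rewrite /pvalid loop_valid /=.
by apply/eqP/eqP => [[->] //|/word_eq ->].
Qed.

Lemma rel_mult_loop c (v w : seq arrow) (a : arrow) :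
  @rel_mult loop_quiver K (c, (tt, v), @QRel loop_quiver K tt tt [:: (1, nseq m a)], (tt, w)) =
  [:: (c, (tt, w ++ nseq m a ++ v))].
Proof.
have e : endpt (tt : vert loop_quiver) w = tt by case: (endpt _ _).
by rewrite /rel_mult /pvalid !loop_valid e !eqxx /= mulr1.
Qed.

Lemma deg_coeff_rel t k : loop_rels t.1.2 -> (k < m)%N -> deg_coeff (rel_mult t) k = 0.
Proof.
case: t => [[[c a] r] b] /= [a0 ->] km; rewrite /deg_coeff.
case: ifP => _; last by rewrite big_nil.
rewrite /= big_cons big_nil /= !size_cat size_nseq; case: eqP => // e; lia.
Qed.

Hypothesis m_gt0 : (0 < m)%N.

Lemma in_ideal_loop u : in_ideal loop_rels u <-> forall k, (k < m)%N -> deg_coeff u k = 0.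
Proof.
split=> [[s us] k km|u0].
  (* If there is no arrow, positive lengths carry no word and the sum is empty. *)
  have [[w kw]|nw] := classic (exists w : seq arrow, size w = k); last first.
    by apply: big_pred0 => c; apply/eqP => e; apply: nw; exists c.2.2.
  rewrite -kw -(coeff_deg u (tt, w)) us; last exact: loop_valid.
  rewrite coeff_deg /= kw /deg_coeff big_flatten big_map big1 // => t _.
  exact: (@deg_coeff_rel (t.1.1.1, t.1.1.2, proj1_sig t.1.2, t.2) k (proj2_sig t.1.2) km).
have [s es] : exists s : seq (K * qpath loop_quiver * {r | loop_rels r} * qpath loop_quiver),
    flatten [seq rel_mult (t.1.1.1, t.1.1.2, proj1_sig t.1.2, t.2) | t <- s] =
    [seq c <- u | m <= size c.2.2]%N.
  elim: {u0} u => [|[c [[] w]] u [s es]]; first by exists [::].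
  have [mw|wm] := leqP m (size w); last by exists s; rewrite es /= ifN // -ltnNge.
  have [a _] : exists a : arrow, True.
    by case: w mw => [|a w] mw; [move: m_gt0 mw; case: m | exists a].
  (* A word of length at least [m] is the relation followed by the remaining [size w - m] loops. *)
  exists ((c, (tt, drop m w), exist _ (@QRel loop_quiver K tt tt [:: (1, nseq m a)])
    (ex_intro _ a erefl), (tt, [::])) :: s).
  rewrite -[LHS]/(@rel_mult loop_quiver K (c, (tt, drop m w),
    @QRel loop_quiver K tt tt [:: (1, nseq m a)], (tt, [::])) ++
    flatten [seq rel_mult (t.1.1.1, t.1.1.2, proj1_sig t.1.2, t.2) | t <- s]).
  rewrite es rel_mult_loop /= mw.
  congr ((_, (_, _)) :: _).
  by apply: word_eq; rewrite size_cat size_nseq size_drop subnKC.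
exists s => q _; rewrite es !coeff_deg /deg_coeff big_filter_cond /=.
have [lt|ge] := ltnP (size q.2) m.
  rewrite -/(deg_coeff u (size q.2)) u0 // big_pred0 // => c.
  by apply/andP => -[h /eqP e]; move: lt; rewrite -e ltnNge h.
by apply: eq_bigl => c; case: eqP => [->|_]; rewrite ?ge ?andbF.
Qed.

Lemma loop_nilpotent : exists n : nat, forall q : qpath loop_quiver,
  pvalid q -> (n <= size q.2)%N -> in_ideal loop_rels [:: (1, q)].
Proof.
exists m => q _ mq; apply/in_ideal_loop => k km.
rewrite /deg_coeff big_cons big_nil /=; case: eqP => // e.
by move: km; rewrite -e ltnNge mq.
Qed.

Definition loop_bquiver : bquiver K := BQuiver loop_rels_wf loop_nilpotent.

Lemma in_rep_loop (d : unit -> nat) (V : @qrep K loop_bquiver d) :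
  in_rep V <-> forall a, (V a : 'M_(d tt)) ^+ m = 0.
Proof.
have pevE a : conform_mx (0 : 'M_(d tt)) (pev V tt (nseq m a)) = (V a : 'M_(d tt)) ^+ m.
  rewrite (@pev_loops K loop_bquiver d V tt) //; last by elim: m.
  elim: m => [|k IHk] /=; first by rewrite expr0.
  by rewrite IHk /loop_mx conform_mx_id -expmxSr.
split=> [hV a|hV _ [a ->]].
  have := hV _ (ex_intro _ a erefl); rewrite /satisfies_rel /= big_seq1 /= scale1r.
  by rewrite pevE.
by rewrite /satisfies_rel /= big_seq1 /= scale1r pevE hV.
Qed.

End LoopQuiver.

(** Representations act on columns and [homs] on rows, so [W f = f V] is the relation [A g = g B]
    with [A = W] and [B = V]: the roles of source and target are exchanged and nothing is
    transposed. *)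
Lemma loop_hom_irreducible (K : closedFieldType) m (m_gt0 : (0 < m)%N) :
  bq_hom_irreducible (loop_bquiver K m_gt0).
Proof.
move=> e d; pose p := d tt; pose q := e tt.
pose phi (P : triple K p q) : @Htype K (loop_bquiver K m_gt0) e d :=
  (((fun=> P.1.2), (fun=> P.1.1)),
   (fun x : unit => match x as y return 'M[K]_(d y, e y) with tt => P.2 end)).
apply: (zirreducible_image (@homs_irreducible K m p q) (phi := phi)).
- exists (0, 0, 0); split=> /=; rewrite ?mul0mx ?mulmx0 //.
    by rewrite -(prednK m_gt0) expmxS mul0mx.
  by rewrite -(prednK m_gt0) expmxS mul0mx.
- move=> f [[a [i [j ->]]]|[[a [i [j ->]]]|[[] [i [j ->]]]]].
  + exact: regmx_B.
  + exact: regmx_A.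
  + exact: regmx_g.
- move=> P [A0 B0 AgB]; split; first by apply/in_rep_loop.
  by split=> //; apply/in_rep_loop.
- move=> [[V W] g] [/in_rep_loop hV [/in_rep_loop hW WgV]]; rewrite /= in WgV.
  (* There is at most one arrow, so the sum is its matrix, or 0 if there is none. *)
  pose B : 'M[K]_q := \sum_a (V a : 'M_q); pose A : 'M[K]_p := \sum_a (W a : 'M_p).
  have sumE n (F : 'I_(1 < m)%N -> 'M[K]_n) a : F a = \sum_b F b.
    rewrite (bigD1 a) //= big1 ?addr0 // => b /negP[].
    by rewrite (arrow_eq b a).
  exists (A, B, g tt).
    have [[a _]|na] := classic (exists a : 'I_(1 < m)%N, True).
      by rewrite /A /B -!(sumE _ _ a); split; [exact: hW | exact: hV | exact: WgV].
    have nb (b : 'I_(1 < m)%N) : False by apply: na; exists b.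
    rewrite /A /B !big1; try by move=> b; case: (nb b).
    by split; rewrite /= ?mul0mx ?mulmx0 // -(prednK m_gt0) expmxS mul0mx.
  apply: (f_equal2 pair); first apply: (f_equal2 pair).
  + by apply: functional_extensionality_dep => a; apply: sumE.
  + by apply: functional_extensionality_dep => a; apply: sumE.
  + by apply: functional_extensionality_dep => -[].
Qed.

(** * Polynomials in an element of a corner ring *)

(* The name scalemx of Defs is shadowed by the homonymous MathComp definition. *)
Local Notation kscale := Defs.scalemx.

Section ScaleMx.
Variables (K : fieldType) (A : falgType K).

Lemma kscaleDl a b c d (M : 'M[A]_(a, b)) : kscale (c + d : K) M = kscale c M + kscale d M.
Proof. by apply/matrixP => i j; rewrite !mxE scalerDl. Qed.

Lemma kscaleDr a b (c : K) (M N : 'M[A]_(a, b)) : kscale c (M + N) = kscale c M + kscale c N.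
Proof. by apply/matrixP => i j; rewrite !mxE scalerDr. Qed.

Lemma kscale0l a b (M : 'M[A]_(a, b)) : kscale (0 : K) M = 0.
Proof. by apply/matrixP => i j; rewrite !mxE scale0r. Qed.

Lemma kscale0r a b (c : K) : kscale c (0 : 'M[A]_(a, b)) = 0.
Proof. by apply/matrixP => i j; rewrite !mxE scaler0. Qed.

Lemma kscale1 a b (M : 'M[A]_(a, b)) : kscale (1 : K) M = M.
Proof. by apply/matrixP => i j; rewrite !mxE scale1r. Qed.

Lemma kscaleA a b (c d : K) (M : 'M[A]_(a, b)) : kscale c (kscale d M) = kscale (c * d) M.
Proof. by apply/matrixP => i j; rewrite !mxE scalerA. Qed.

Lemma kscale_sum a b (c : K) I (r : seq I) (F : I -> 'M[A]_(a, b)) :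
  kscale c (\sum_(i <- r) F i) = \sum_(i <- r) kscale c (F i).
Proof.
elim: r => [|i r IHr]; first by rewrite !big_nil kscale0r.
by rewrite !big_cons kscaleDr IHr.
Qed.

Lemma kscale_mull a b d (c : K) (M : 'M[A]_(a, b)) (N : 'M[A]_(b, d)) :
  kscale c M *m N = kscale c (M *m N).
Proof.
apply/matrixP => i j; rewrite !mxE scaler_sumr; apply: eq_bigr => k _.
by rewrite !mxE scalerAl.
Qed.

Lemma kscale_mulr a b d (c : K) (M : 'M[A]_(a, b)) (N : 'M[A]_(b, d)) :
  M *m kscale c N = kscale c (M *m N).
Proof.
apply/matrixP => i j; rewrite !mxE scaler_sumr; apply: eq_bigr => k _.
by rewrite !mxE scalerAr.
Qed.

End ScaleMx.

Section PolynomialEvaluation.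
Variables (K : fieldType) (A : falgType K) (n : nat) (e x : 'M[A]_n.+1).
Hypotheses (ee : e *m e = e) (exe : e *m x *m e = x).

(** Evaluation in the corner ring, whose unit is [e]. The form makes it convertible to the [eval] of
    [morita_trunc_poly]. *)
Definition evp (p : {poly K}) : 'M[A]_n.+1 :=
  \sum_(i < size p) kscale p`_i (e *m x ^+ i).

Lemma corner_mull : e *m x = x.
Proof. by rewrite -exe !mulmxA ee. Qed.

Lemma corner_mulr : x *m e = x.
Proof. by rewrite -exe -mulmxA ee. Qed.

Lemma expx_e i : x ^+ i *m e = e *m x ^+ i.
Proof.
elim: i => [|i IHi]; first by rewrite expr0 mulmx1 mul1mx.
by rewrite exprS -mulmxA IHi !mulmxA corner_mulr corner_mull.
Qed.

Lemma evp_widen (p : {poly K}) N : (size p <= N)%N ->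
  evp p = \sum_(i < N) kscale p`_i (e *m x ^+ i).
Proof.
move=> pN; rewrite /evp (big_ord_widen N (fun i => kscale p`_i (e *m x ^+ i)) pN) big_mkcond.
apply: eq_bigr => i _; case: ltnP => // pi.
by rewrite nth_default // kscale0l.
Qed.

Lemma evpD (p q : {poly K}) : evp (p + q) = evp p + evp q.
Proof.
pose N := maxn (size p) (size q).
rewrite (@evp_widen p N) ?leq_maxl // (@evp_widen q N) ?leq_maxr //.
rewrite (@evp_widen (p + q) N) ?size_polyD // -big_split /=.
by apply: eq_bigr => i _; rewrite coefD kscaleDl.
Qed.

Lemma evpZ c (p : {poly K}) : evp (c *: p) = kscale c (evp p).
Proof.
rewrite (@evp_widen _ (size p)) ?size_scale_leq // kscale_sum.
by apply: eq_bigr => i _; rewrite coefZ kscaleA.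
Qed.

Lemma evpXn k : evp 'X^k = e *m x ^+ k.
Proof.
rewrite /evp size_polyXn big_ord_recr /= big1 ?add0r => [|i _].
  by rewrite coefXn eqxx kscale1.
by rewrite coefXn ltn_eqF // kscale0l.
Qed.

Lemma evp0 : evp 0 = 0.
Proof. by rewrite /evp size_poly0 big_ord0. Qed.

Lemma evp_sum I (r : seq I) (F : I -> {poly K}) :
  evp (\sum_(i <- r) F i) = \sum_(i <- r) evp (F i).
Proof.
elim: r => [|i r IHr]; first by rewrite !big_nil evp0.
by rewrite !big_cons evpD IHr.
Qed.

Lemma evpMXn (p : {poly K}) k : evp (p * 'X^k) = evp p *m x ^+ k.
Proof.
rewrite -[p in LHS]coefK poly_def mulr_suml evp_sum mulmx_suml.
rewrite /index_enum; apply: eq_bigr => i _.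
by rewrite -scalerAl -exprD evpZ evpXn kscale_mull exprD mulmxA.
Qed.

Lemma evpM (p q : {poly K}) : evp (p * q) = evp p *m evp q.
Proof.
rewrite -[q in LHS]coefK poly_def mulr_sumr evp_sum mulmx_sumr.
rewrite /index_enum; apply: eq_bigr => i _.
rewrite -scalerAr evpZ evpMXn kscale_mulr mulmxA; congr (kscale _ (_ *m _)).
rewrite /evp mulmx_suml; apply: eq_bigr => j _.
by rewrite kscale_mull -mulmxA expx_e mulmxA ee.
Qed.

Lemma dvdXn_coef m (p : {poly K}) : 'X^m %| p <-> forall k, (k < m)%N -> p`_k = 0.
Proof.
split=> [/dvdpP[q ->] k km|p0]; first by rewrite coefMXn km.
rewrite -(poly_take_drop m p); have -> : take_poly m p = 0; last by rewrite add0r dvdp_mull.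
by apply/polyP => k; rewrite coef_take_poly coef0; case: ifP => // /p0.
Qed.

(** Take the least [m] with ['X^m] in the kernel. For [p = q * 'X^j] in the kernel with [q] nonzero
    at 0, a Bezout relation between [q] and ['X^m] puts ['X^j] in the kernel, so [m <= j]. *)
Lemma evp_kernel N : e != 0 -> evp 'X^N = 0 ->
  exists m, (0 < m)%N /\ forall p, evp p = 0 <-> 'X^m %| p.
Proof.
move=> e0 /eqP evN; have exN : exists N, evp 'X^N == 0 by exists N.
case: (ex_minnP exN) => m /eqP evm minm; exists m; split.
  case: m evm {minm} => // /eqP; rewrite evpXn expr0 mulmx1 => e0'.
  by rewrite e0' in e0.
move=> p; split=> [evp0'|/dvdpP[q ->]]; last by rewrite evpM evm mulmx0.
have [->|p0] := eqVneq p 0; first exact: dvdp0.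
have [j [q qn pE]] := multiplicity_XsubC p 0.
rewrite p0 /= in qn; rewrite subr0 in pE.
have /Bezout_eq1_coprimepP[[u v] /= uv] : coprimep q 'X^m.
  by rewrite coprimep_expr // coprimepX.
have jm : (m <= j)%N.
  apply: minm; rewrite -['X^j]mul1r -uv mulrDl evpD -mulrA -pE evpM evp0' mulmx0 add0r.
  by rewrite -mulrA [_ * 'X^j]mulrC mulrA evpM evm mulmx0.
by rewrite pE dvdp_mull // dvdp_exp2l.
Qed.

End PolynomialEvaluation.

Lemma morita_loop (K : fieldType) (A : falgType K) m (m_gt0 : (0 < m)%N) :
  morita_trunc_poly A m -> morita_bq A (loop_bquiver K m_gt0).
Proof.
case=> n [e [fe [x [exe [ker onto]]]]]; have [ee _] := fe.
exists n, e; split=> //; exists (fun=> e), (fun=> x).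
split; first by [].
split; first by move=> [] [].
split; first by rewrite (big_pred1 tt) // => -[].
split; first by move=> a; rewrite exe.
move=> peval eval.
pose pol (u : kQ (loop_quiver m) K) : {poly K} := \sum_(c <- u) c.1 *: 'X^(size c.2.2).
have pevalE q : peval q = e *m x ^+ (size q.2).
  case: q => -[] w; rewrite /peval /pvalid loop_valid /= -(expx_e ee exe).
  elim/last_ind: w => [|w a IHw] /=; first by rewrite expr0 mul1mx.
  by rewrite foldl_rcons IHw size_rcons exprS mulmxA.
have evalE u : eval u = evp e x (pol u).
  by rewrite evp_sum; apply: eq_bigr => c _; rewrite evpZ evpXn pevalE.
have polE u k : (pol u)`_k = deg_coeff u k.
  rewrite coef_sum /deg_coeff [RHS]big_mkcond; apply: eq_bigr => c _.
  by rewrite coefZ coefXn eq_sym; case: eqP; rewrite ?mulr1 ?mulr0.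
have {}ker p : evp e x p = 0 <-> 'X^m %| p := ker p.
split=> [u|M /onto[p]]; last rewrite -/(evp e x p) => <-.
  rewrite evalE (ker (pol u)) dvdXn_coef (in_ideal_loop m_gt0).
  by split=> h k /h; rewrite polE.
(* The word of length [i]. For [m = 1] there is no arrow and only [i = 0] is available, hence the
   truncation of [p] below degree [m]. *)
pose w i : seq 'I_(1 < m)%N := flatten (nseq i (enum 'I_(1 < m)%N)).
have sw i : (i < m)%N -> size (w i) = i.
  move=> im; rewrite size_flatten /shape map_nseq sumn_nseq size_enum_ord.
  by case: ltnP; rewrite ?mul1n // mul0n; lia.
pose p' := take_poly m p.
exists [seq (p'`_i, (tt, w i)) | i <- iota 0 (size p')].
have -> : evp e x p = evp e x p'.
  rewrite -[p in LHS](poly_take_drop m p) evpD; have /ker -> : 'X^m %| drop_poly m p * 'X^m.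
    exact: dvdp_mull.
  by rewrite addr0.
rewrite /eval big_map /evp.
rewrite -(big_mkord xpredT (fun i => kscale p'`_i (e *m x ^+ i))) /index_iota subn0.
apply: eq_big_seq => i; rewrite mem_iota add0n => /andP[_ ip].
by rewrite pevalE /= sw // (leq_trans ip) // size_take_poly.
Qed.

(** * Quivers with a reducible variety of homomorphisms *)

(** Elements of the path algebra are lists, compared by coefficients. Grouping terms by path shows
    that an additive evaluation depends on the coefficients only. *)
Lemma coeff_sum (Q : quiver) (K : fieldType) (W : nmodType) (h : qpath Q -> K -> W)
    (u v : kQ Q K) :
  (forall q, h q 0 = 0) -> (forall q c d, h q (c + d) = h q c + h q d) ->
  (forall q, pvalid q -> coeff u q = coeff v q) ->
  \sum_(c <- u | pvalid c.2) h c.2 c.1 = \sum_(c <- v | pvalid c.2) h c.2 c.1.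
Proof.
move=> h0 hD uv; pose S := undup (map snd (u ++ v)).
have expand t : {subset map snd t <= S} ->
    \sum_(c <- t | pvalid c.2) h c.2 c.1 = \sum_(q <- S | pvalid q) h q (coeff t q).
  elim: t => [|c t IHt] sub.
    by rewrite big_nil big1 // => q _; rewrite /coeff big_nil h0.
  have cS : c.2 \in S by apply: sub; rewrite mem_head.
  rewrite big_cons IHt; last by move=> q qt; apply: sub; rewrite inE qt orbT.
  case: ifP => vc; last first.
    by apply: eq_bigr => q _; rewrite /coeff big_cons vc.
  rewrite [X in _ + X]big_mkcond [RHS]big_mkcond /=.
  rewrite (bigD1_seq c.2) ?undup_uniq //= [RHS](bigD1_seq c.2) ?undup_uniq //= vc addrA.
  congr (_ + _); first by rewrite -hD [in RHS]/coeff big_cons vc eqxx.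
  apply: eq_bigr => q qc; case: ifP => // _.
  by rewrite [in RHS]/coeff big_cons eq_sym (negbTE qc) andbF.
rewrite !expand; first by apply: eq_bigr => q /uv ->.
all: by move=> q qt; rewrite mem_undup map_cat mem_cat qt ?orbT.
Qed.

(** * Representations annihilate the ideal of relations *)

Section Evaluation.
Variables (K : fieldType) (L : bquiver K) (d : vert (bq L) -> nat) (V : qrep d).
Implicit Types (x y z : vert (bq L)) (w : seq (arr (bq L))).

Lemma valid_cat x w1 w2 :
  valid_from x (w1 ++ w2) = valid_from x w1 && valid_from (endpt x w1) w2.
Proof. by elim: w1 x => //= a w1 IHw x; rewrite IHw andbA. Qed.

Lemma endpt_cat x w1 w2 : endpt x (w1 ++ w2) = endpt (endpt x w1) w2.
Proof. exact: foldl_cat. Qed.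

Lemma pev_cat x y z w1 w2 : y = endpt x w1 -> z = endpt y w2 ->
  conform_mx (0 : 'M_(d z, d x)) (pev V x (w1 ++ w2)) =
  conform_mx (0 : 'M_(d z, d y)) (pev V y w2) *m conform_mx (0 : 'M_(d y, d x)) (pev V x w1).
Proof.
elim: w1 x => [|a w1 IHw] x /= ey ez; first by subst y; rewrite !conform_mx_id mulmx1.
rewrite (@conform_mulmx _ _ _ _ (d z) (d (tgt a)) (d x)) //; last first.
  by rewrite ez ey -endpt_cat.
rewrite (IHw (tgt a) ey ez) -mulmxA; congr (_ *m _).
by rewrite (@conform_mulmx _ _ _ _ (d y) (d (tgt a)) (d x)) // ey.
Qed.

Definition path_entry x z (q : qpath (bq L)) (c : K) : 'M[K]_(d z, d x) :=
  if (q.1 == x) && (endpt q.1 q.2 == z) then c *: conform_mx 0 (pev V q.1 q.2) else 0.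

Lemma path_entry_rel x z t : in_rep V -> brels t.1.2 ->
  \sum_(c <- rel_mult t | pvalid c.2) path_entry x z c.2 c.1 = 0.
Proof.
case: t => [[[c [a1 a2]] r] [b1 b2]] /= hV hr; rewrite /rel_mult /=.
case: ifP => [/and4P[vb /eqP eb va /eqP ea]|_]; last by rewrite big_nil.
rewrite big_map.
have wf : all (fun c => [&& valid_from (rs r) c.2, endpt (rs r) c.2 == rt r
                  & (2 <= size c.2)%N]) (rterms r) := brels_wf hr.
have [/andP[/eqP ex /eqP ez]|ne] := boolP ((b1 == x) && (endpt a1 a2 == z)); last first.
  rewrite big_seq_cond big1 // => ct /andP[/(allP wf)/and3P[_ /eqP et _] _].
  by rewrite /path_entry ifN //= !endpt_cat eb et -ea.
subst b1.
transitivity (\sum_(ct <- rterms r)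
   c *: (conform_mx (0 : 'M_(d z, d (rt r))) (pev V (rt r) a2) *m
   (ct.1 *: conform_mx (0 : 'M_(d (rt r), d (rs r))) (pev V (rs r) ct.2)) *m
   conform_mx (0 : 'M_(d (rs r), d x)) (pev V x b2))).
  rewrite big_seq_cond [RHS]big_seq.
  apply: eq_big => [ct|ct /andP[/(allP wf)/and3P[vt /eqP et _] _]].
    rewrite andb_idr // => /(allP wf)/and3P[vt /eqP et _].
    by rewrite /pvalid /= !valid_cat eb et vt -ea -[valid_from x b2]/(pvalid (x, b2)) vb.
  rewrite /path_entry ifT /=; last by rewrite !endpt_cat eb et -ea ez !eqxx.
  rewrite (@pev_cat x (rs r) z) ?endpt_cat ?et -?ea //.
  rewrite (@pev_cat (rs r) (rt r) z) -?ea // ?ea //.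
  by rewrite -!scalemxAr -!scalemxAl scalerA.
rewrite -scaler_sumr -mulmx_suml -mulmx_sumr.
by have := hV r hr; rewrite /satisfies_rel => ->; rewrite mulmx0 mul0mx scaler0.
Qed.

Lemma ideal_pev x w : in_rep V -> valid_from x w ->
  in_ideal (@brels K L) [:: (1, (x, w))] -> pev V x w = 0.
Proof.
move=> hV vw [s us].
have peE : path_entry x (endpt x w) (x, w) 1 = pev V x w.
  by rewrite /path_entry ifT ?eqxx // scale1r conform_mx_id.
have -> : pev V x w = \sum_(c <- [:: (1, (x, w))] | pvalid c.2)
    path_entry x (endpt x w) c.2 c.1.
  by rewrite big_cons big_nil -[pvalid _]/(valid_from x w) vw addr0 peE.
rewrite (@coeff_sum _ K _ (path_entry x (endpt x w)) _ _ _ _ us).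
- rewrite big_flatten big_map big1 // => t _.
  exact: (@path_entry_rel _ _ (t.1.1.1, t.1.1.2, proj1_sig t.1.2, t.2) hV (proj2_sig t.1.2)).
- by move=> q; rewrite /path_entry scale0r if_same.
- by move=> q c c'; rewrite /path_entry; case: ifP; rewrite ?addr0 // scalerDl.
Qed.

(** Long paths belong to the ideal by [bnilp], so every representation sends them to zero. *)
Lemma loop_words_nilpotent x : in_rep V ->
  exists N : nat, forall w, all (fun a => (src a == x) && (tgt a == x)) w ->
    (N <= size w)%N -> loop_word V x w = 0.
Proof.
move=> hV; have [N HN] := bnilp L; exists N => w lw Nw.
have vw : valid_from x w.
  elim: w {Nw} lw => //= a w IHw /andP[/andP[-> /eqP ->] lw] /=.
  exact: IHw.
by rewrite -(@pev_loops K L d V x x w) // ideal_pev ?conform_mx0 //; apply: (HN (x, w)).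
Qed.

End Evaluation.

Lemma conform_matrix (R : nzRingType) a b a' b' (F : nat -> nat -> R) :
  a = a' -> b = b' ->
  conform_mx (0 : 'M_(a', b')) (\matrix_(i < a, j < b) F i j) = \matrix_(i < a', j < b') F i j.
Proof. by move=> -> ->; rewrite conform_mx_id. Qed.

Lemma conform_entry (R : nzRingType) a b a' b' (i : 'I_a') (j : 'I_b') :
  a = a' -> b = b' ->
  exists i' j', forall M : 'M[R]_(a, b), conform_mx 0 M i j = M i' j'.
Proof. by move=> ea eb; subst a' b'; exists i, j => M; rewrite conform_mx_id. Qed.

(** * Nilpotent matrices of size two *)

Section TwoByTwo.
Variable K : fieldType.
Implicit Types M N : 'M[K]_2.

Lemma ord2P (P : 'I_2 -> Prop) : P 0 -> P 1 -> forall i, P i.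
Proof.
move=> P0 P1 [[|[|i]] lt] //; [have -> : Ordinal lt = 0 | have -> : Ordinal lt = 1];
  by [apply: val_inj |].
Qed.

Lemma mulmx2E M N i j : (M *m N) i j = M i 0 * N 0 j + M i 1 * N 1 j.
Proof.
by rewrite mxE big_ord_recl big_ord1; congr (_ + M i _ * N _ j); apply: val_inj.
Qed.

Lemma det2E M : \det M = M 0 0 * M 1 1 - M 0 1 * M 1 0.
Proof.
rewrite (expand_det_row _ 0) big_ord_recl big_ord1 /cofactor !det_mx11 !mxE.
have e1 : lift 0 0 = 1 :> 'I_2 by apply: val_inj.
have e2 : lift 1 0 = 0 :> 'I_2 by apply: val_inj.
by rewrite !e1 !e2 expr0 expr1 mul1r mulN1r mulrN.
Qed.

(** The determinant is nilpotent, hence zero; then [M *m M = t *: M] for the trace [t], so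
    [M ^+ k.+1 = t ^+ k *: M] and [t] vanishes as well. *)
Lemma nilpotent_2x2 M n : M ^+ n = 0 ->
  M 0 0 + M 1 1 = 0 /\ M 0 0 * M 1 1 = M 0 1 * M 1 0.
Proof.
move=> Mn; have dM : \det M = 0.
  have detX k : \det (M ^+ k) = \det M ^+ k.
    by elim: k => [|k IHk]; rewrite ?expr0 ?det1 // expmxS det_mulmx IHk exprS.
  by have /eqP := detX n; rewrite Mn det0 eq_sym expf_eq0 => /andP[_ /eqP].
have {}dM : M 0 0 * M 1 1 = M 0 1 * M 1 0 by apply/eqP; rewrite -subr_eq0 -det2E dM.
split=> //; set t := _ + _.
have MM : M *m M = t *: M.
  apply/matrixP; apply: ord2P; apply: ord2P; rewrite mulmx2E mxE /t; try ring.
  - by rewrite mulrDl [M 1 1 * _]mulrC dM.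
  - by rewrite mulrDl dM [M 0 1 * _]mulrC.
have MX k : M ^+ k.+1 = t ^+ k *: M.
  elim: k => [|k IHk]; first by rewrite expr1 expr0 scale1r.
  by rewrite expmxS IHk -scalemxAr MM scalerA -exprSr.
have /eqP : M ^+ n.+1 = 0 by rewrite expmxS Mn mulmx0.
rewrite MX scaler_eq0 => /orP[|/eqP M0]; first by rewrite expf_eq0 => /andP[_ /eqP].
by rewrite /t M0 !mxE addr0.
Qed.

(** The matrices are [a] with rows [(p, q)], [(r, - p)] and [b] with rows [(s, u)], [(v, - s)], of
    determinant zero and with [a *m b] of trace zero. The squares of the two differences lie in the
    ideal generated by these equations. *)
Lemma traceless_square_zero (p q r s u v : K) :
  p * s + q * v + (r * u + - p * - s) = 0 -> p * - p = q * r -> s * - s = u * v ->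
  p * u = q * s /\ q * v = u * r.
Proof.
move=> tab da db; split; apply/eqP; rewrite -subr_eq0 -sqrf_eq0; apply/eqP.
  have -> : (p * u - q * s) ^+ 2 =
    - (q * u) * (p * s + q * v + (r * u + - p * - s)) - u ^+ 2 * (p * - p - q * r)
    - q ^+ 2 * (s * - s - u * v) by ring.
  by rewrite tab da db !subrr !mulr0 !subr0.
have -> : (q * v - u * r) ^+ 2 =
  (p * s + q * v + (r * u + - p * - s)) * (q * v + u * r - p * s *+ 2)
   + (p * - p - q * r) * (u * v) *+ 4 - p ^+ 2 * (s * - s - u * v) *+ 4 by ring.
by rewrite tab da db !subrr !mul0r !mulr0 !mul0rn !addr0 subr0.
Qed.

Lemma nilpotent_proportional (a b : 'M[K]_2) n :
  a ^+ n = 0 -> b ^+ n = 0 -> (a *m b) ^+ n = 0 -> a 0 1 *: b = b 0 1 *: a.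
Proof.
move=> /nilpotent_2x2[ta da] /nilpotent_2x2[tb db] /nilpotent_2x2[tab _].
have a11 : a 1 1 = - a 0 0 by apply/eqP; rewrite -addr_eq0 addrC ta.
have b11 : b 1 1 = - b 0 0 by apply/eqP; rewrite -addr_eq0 addrC tb.
rewrite !mulmx2E a11 b11 in tab da db.
have [e1 e2] := traceless_square_zero tab da db.
apply/matrixP; apply: ord2P; apply: ord2P; rewrite !mxE ?a11 ?b11.
- by rewrite -e1 mulrC.
- by rewrite mulrC.
- by [].
- by rewrite !mulrN -e1 mulrC.
Qed.

End TwoByTwo.

Section Reducible.
Variables (K : fieldType) (L : bquiver K).
Local Notation vertex := (vert (bq L)).
Local Notation arrow := (arr (bq L)).

(** Every path in a relation has length at least 2, so it begins with two consecutive arrows, whose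
    product vanishes. *)
Lemma in_rep_two_step (d : vertex -> nat) (V : qrep d) :
  (forall a b : arrow, tgt a = src b ->
    V b *m conform_mx (0 : 'M_(d (src b), d (src a))) (V a) = 0) ->
  in_rep V.
Proof.
move=> VV r hr; have wf := brels_wf hr.
rewrite /satisfies_rel big_seq big1 // => ct /(allP wf)/and3P[vw _ sw].
move: (ct.2) vw sw => -[|a [|b w]] // vw _.
case/and3P: vw => /eqP sa /eqP sb _.
suff VV0 : conform_mx (0 : 'M_(d (tgt b), d (tgt a))) (V b) *m
    conform_mx (0 : 'M_(d (tgt a), d (rs r))) (V a) = 0.
  have -> : pev V (rs r) [:: a, b & w] = 0 by rewrite /= -mulmxA VV0 mulmx0.
  by rewrite conform_mx0 scaler0.
move: (VV a b (esym sb)); move: (V a) (V b); rewrite sb sa => Va Vb.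
by rewrite !conform_mx_id.
Qed.

Definition arrow_rep (alpha : arrow) (F : nat -> nat -> K) (d : vertex -> nat) : qrep d :=
  fun a => \matrix_(i, j) (if a == alpha then F i j else 0).

Lemma polyfun_zclosed (T : Type) (coord : (T -> K) -> Prop) f :
  polyfun coord f -> zclosed coord (fun x => f x = 0).
Proof.
move=> pf; exists (eq f); split=> [g <-|x] //.
by split=> [fx g <-|] //; apply.
Qed.

Lemma reducible_pair (T : Type) (coord : (T -> K) -> Prop) (X : T -> Prop) f g x y :
  polyfun coord f -> polyfun coord g -> (forall z, X z -> f z = 0 \/ g z = 0) ->
  X x -> f x <> 0 -> X y -> g y <> 0 -> ~ zirreducible coord X.
Proof.
move=> pf pg cov Xx fx Xy gy [_ irr].
by case: (irr _ _ (polyfun_zclosed pf) (polyfun_zclosed pg) cov) => [/(_ x Xx)|/(_ y Xy)].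
Qed.

Definition zero_rep (d : vertex -> nat) : qrep d := fun a => 0.

Lemma in_rep0 (d : vertex -> nat) : in_rep (zero_rep d).
Proof. by apply: in_rep_two_step => a b _; rewrite mul0mx. Qed.

Lemma in_rep_arrow (alpha : arrow) F (d : vertex -> nat) :
  src alpha <> tgt alpha \/ (forall i j k, F i j * F j k = 0) ->
  in_rep (arrow_rep alpha F d).
Proof.
move=> nFF; apply: in_rep_two_step => a b ab.
have ea : d (tgt a) = d (src b) by rewrite ab.
pose Fa i j := if a == alpha then F i j else 0.
rewrite /arrow_rep (@conform_matrix _ _ _ _ _ Fa ea erefl) /Fa.
apply/matrixP => i j; rewrite !mxE big1 // => k _; rewrite !mxE.
case: eqP => [eb|]; last by rewrite mul0r.
case: eqP => [eqa|]; last by rewrite mulr0.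
by case: nFF => [[]|->] //; rewrite -{1}eb -eqa ab.
Qed.

(* For e = 1 at the source of alpha and d = 1 at both its ends, the equation of
   the variety is W_alpha f = 0 with scalars W_alpha and f. *)
Lemma nonloop_reducible (alpha : arrow) : src alpha <> tgt alpha -> ~ bq_hom_irreducible L.
Proof.
move=> st irr; set s := src alpha; set t := tgt alpha.
pose e (y : vertex) : nat := (y == s); pose d (y : vertex) : nat := (y == s) || (y == t).
have [ds dt es et] : [/\ d s = 1%N, d t = 1%N, e s = 1%N & e t = 0%N].
  by rewrite /d /e !eqxx orbT; split=> //; case: eqP => // ts; case: st.
have i0 : 'I_(d t) by rewrite dt; exact: ord0.
have j0 : 'I_(d s) by rewrite ds; exact: ord0.
have k0 : 'I_(e s) by rewrite es; exact: ord0.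
pose P1 : Htype e d := (zero_rep e, arrow_rep alpha (fun _ _ => 1) d, fun=> 0).
pose P2 : Htype e d := (zero_rep e, zero_rep d, fun=> const_mx 1).
apply: (@reducible_pair _ (@Hcoord K L e d) (@Hset K L e d)
  (fun P => P.1.2 alpha i0 j0) (fun P => P.2 s j0 k0) P1 P2 _ _ _ _ _ _ _ (irr e d)).
- by apply: pf_coord; right; left; exists alpha, i0, j0.
- by apply: pf_coord; right; right; exists s, j0, k0.
- move=> P [_ [_ WfV]]; have /matrixP/(_ i0 k0) := WfV alpha.
  rewrite !mxE (bigD1 j0) //= big1 => [|j nj]; last first.
    by case/eqP: nj; apply: ord_inj; have := ltn_ord j; have := ltn_ord j0; move: ds; lia.
  (* The side [f_t V_alpha] is an empty sum, because [e t = 0]. *)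
  rewrite addr0 big1 => [|k _]; last by have : (k < 0)%N by rewrite -et; exact: ltn_ord.
  by move=> /eqP; rewrite mulf_eq0 => /orP[/eqP ->|/eqP ->]; [left | right].
- split; first exact: in_rep0.
  split; first by apply: in_rep_arrow; left.
  by move=> a; rewrite /= mulmx0 mul0mx.
- by rewrite /P1 /= mxE eqxx; apply/eqP; rewrite oner_eq0.
- split; first exact: in_rep0.
  split; first exact: in_rep0.
  by move=> a; rewrite /= mulmx0 mul0mx.
- by rewrite /P2 /= mxE; apply/eqP; rewrite oner_eq0.
Qed.

Lemma loop_mx_entry (d : vertex -> nat) x (a : arrow) (i j : 'I_(d x)) :
  src a = x -> tgt a = x -> exists i' j', forall V : qrep d, loop_mx V x a i j = V a i' j'.
Proof.
move=> sa ta; have [|| i' [j' H]] := @conform_entry K (d (tgt a)) (d (src a)) _ _ i j.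
- by rewrite ta.
- by rewrite sa.
by exists i', j' => V; apply: H.
Qed.

Lemma loop_mx_hom (d : vertex -> nat) x (a : arrow) (V W : qrep d)
    (f : forall y, 'M[K]_(d y, d y)) : src a = x -> tgt a = x ->
  W a *m f (src a) = f (tgt a) *m V a -> loop_mx W x a *m f x = f x *m loop_mx V x a.
Proof.
rewrite /loop_mx => sa ta; move: (V a) (W a); rewrite sa ta => Va Wa.
by rewrite !conform_mx_id.
Qed.

Lemma two_loops_proportional (n : nat) (a b : 'M[K]_n) (i0 i1 : 'I_n) N :
  n = 2%N -> i0 = 0%N :> nat -> i1 = 1%N :> nat ->
  a ^+ N = 0 -> b ^+ N = 0 -> (a *m b) ^+ N = 0 -> a i0 i1 *: b = b i0 i1 *: a.
Proof.
move=> n2; subst n => e0 e1 aN bN abN.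
have -> : i0 = 0 by apply: val_inj.
have -> : i1 = 1 by apply: val_inj.
exact: nilpotent_proportional aN bN abN.
Qed.

(* In dimension 2 the matrices V_alpha, V_beta are multiples of one nilpotent
   matrix.  If f is invertible then (W_alpha, W_beta) is conjugate to
   (V_alpha, V_beta), so it has the same ratio; but f = 0 allows any ratios. *)
Lemma two_loops_reducible (alpha beta : arrow) :
  alpha <> beta -> src alpha = tgt alpha -> src beta = src alpha -> tgt beta = src alpha ->
  ~ bq_hom_irreducible L.
Proof.
move=> ab ta sb tb irr; set x := src alpha in ta sb tb.
pose d (y : vertex) : nat := if y == x then 2 else 0.
have dx : d x = 2%N by rewrite /d eqxx.
have lt0 : (0 < d x)%N by rewrite dx.
have lt1 : (1 < d x)%N by rewrite dx.
pose i0 := Ordinal lt0; pose i1 := Ordinal lt1.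
pose F (i j : nat) : K := ((i == 0%N) && (j == 1%N))%:R.
pose P1 : Htype d d := (zero_rep d, zero_rep d, fun=> 1%:M).
pose P2 : Htype d d := (arrow_rep alpha F d, arrow_rep beta F d, fun=> 0).
have FF i j k : F i j * F j k = 0.
  by rewrite /F; case: j => [|j]; rewrite ?andbF ?mul0r //= mulr0.
have loop_arrow (a c : arrow) : src a = x -> tgt a = x ->
    loop_mx (arrow_rep c F d) x a i0 i1 = (a == c)%:R.
  move=> sa ta'; rewrite /loop_mx /arrow_rep.
  rewrite (@conform_matrix _ _ _ _ _ (fun i j => if a == c then F i j else 0)) ?sa ?ta' //.
  by rewrite mxE /F /=; case: eqP.
(* [h] compares the ratio of the [(0, 1)] entries of the two loops in [V] with that in [W]. In [P2]
   only [alpha] acts on [V] and only [beta] on [W], so [h] is 1. *)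
pose h (P : Htype d d) := loop_mx P.1.1 x alpha i0 i1 * loop_mx P.1.2 x beta i0 i1 -
  loop_mx P.1.1 x beta i0 i1 * loop_mx P.1.2 x alpha i0 i1.
apply: (@reducible_pair _ (@Hcoord K L d d) (@Hset K L d d)
  (fun P => \det (P.2 x)) h P1 P2 _ _ _ _ _ _ _ (irr d d)).
- by apply: pf_det => i j; apply: pf_coord; right; right; exists x, i, j.
- have pV a i j : src a = x -> tgt a = x ->
      polyfun (@Hcoord K L d d) (fun P => loop_mx P.1.1 x a i j).
    move=> sa ta'; have [i' [j' E]] := @loop_mx_entry d x a i j sa ta'.
    apply: (@pf_ext K (Htype d d) _ (fun P => P.1.1 a i' j')) => [P|]; first by rewrite E.
    by apply: pf_coord; left; exists a, i', j'.
  have pW a i j : src a = x -> tgt a = x ->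
      polyfun (@Hcoord K L d d) (fun P => loop_mx P.1.2 x a i j).
    move=> sa ta'; have [i' [j' E]] := @loop_mx_entry d x a i j sa ta'.
    apply: (@pf_ext K (Htype d d) _ (fun P => P.1.2 a i' j')) => [P|]; first by rewrite E.
    by apply: pf_coord; right; left; exists a, i', j'.
  by apply: pf_sub; apply: pf_mul; [apply: pV | apply: pW | apply: pV | apply: pW].
- move=> [[V W] f] [/= hV [_ WfV]].
  have [df|df] := eqVneq (\det (f x)) 0; [by left | right].
  have uf : f x \in unitmx by rewrite unitmxE unitfE.
  have WE c : src c = x -> tgt c = x -> loop_mx W x c = f x *m loop_mx V x c *m invmx (f x).
    by move=> sc tc; rewrite -(@loop_mx_hom d x c V W f sc tc (WfV c)) mulmxK.
  have [N HN] := loop_words_nilpotent x hV.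
  have powE c k : loop_word V x (nseq k c) = loop_mx V x c ^+ k.
    by elim: k => [|k IHk] /=; rewrite ?expr0 // IHk -expmxSr.
  have prodE k : loop_word V x (flatten (nseq k [:: beta; alpha])) =
      (loop_mx V x alpha *m loop_mx V x beta) ^+ k.
    by elim: k => [|k IHk] /=; rewrite ?expr0 // IHk -mulmxA -expmxSr.
  have la : (src alpha == x) && (tgt alpha == x) by rewrite -ta eqxx.
  have lb : (src beta == x) && (tgt beta == x) by rewrite sb tb eqxx.
  (* Both loops and their product are nilpotent, by [loop_words_nilpotent]. Conjugation by [f x] is
     linear, so the relation passes to [W]. *)
  have prop : loop_mx V x alpha i0 i1 *: loop_mx V x beta =
              loop_mx V x beta i0 i1 *: loop_mx V x alpha.
    apply: (@two_loops_proportional _ _ _ _ _ N dx) => //.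
    + by rewrite -powE HN ?size_nseq // all_nseq la orbT.
    + by rewrite -powE HN ?size_nseq // all_nseq lb orbT.
    + rewrite -prodE HN //.
        by elim: (N) => //= k ->; rewrite la lb.
      by elim: (N) => //= k; lia.
  rewrite /h /= !WE //.
  have ent c d' : loop_mx V x c i0 i1 * (f x *m loop_mx V x d' *m invmx (f x)) i0 i1 =
      (f x *m (loop_mx V x c i0 i1 *: loop_mx V x d') *m invmx (f x)) i0 i1.
    by rewrite -scalemxAr -scalemxAl [RHS]mxE.
  by rewrite !ent prop subrr.
- split; first exact: in_rep0.
  split; first exact: in_rep0.
  by move=> a; rewrite /= mulmx0 mul0mx.
- by rewrite /P1 /= det1; apply/eqP; rewrite oner_eq0.
- split; first by apply: in_rep_arrow; right.
  split; first by apply: in_rep_arrow; right.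
  by move=> a; rewrite /= mulmx0 mul0mx.
- rewrite /h /P2 /= !loop_arrow // !eqxx.
  have /negbTE -> : beta != alpha by apply/eqP => e; apply: ab.
  by rewrite mul0r subr0 mulr1; apply/eqP; rewrite oner_eq0.
Qed.

End Reducible.

(** * Morita equivalence and central idempotents *)

Lemma central_mx_scalar (R : nzRingType) n (Z : 'M[R]_n.+1) :
  (forall M, Z *m M = M *m Z) -> exists2 c, Z = c%:M & forall a, c * a = a * c.
Proof.
move=> cZ.
have entry i j k : Z i k = (Z j j) *+ (i == k).
  have /matrixP/(_ i j) := cZ (delta_mx k j); rewrite !mxE.
  rewrite (bigD1 k) //= big1 => [|l lk]; last by rewrite !mxE (negbTE lk) mulr0.
  rewrite (bigD1 j) //= [X in _ = _ + X]big1 => [|l lj]; last first.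
    by rewrite !mxE (negbTE lj) andbF mul0r.
  by rewrite !mxE !eqxx !andbT mulr1 !addr0 mulr_natl.
have ZE : Z = (Z 0 0)%:M by apply/matrixP => i k; rewrite !mxE -entry.
exists (Z 0 0) => // a; have := cZ a%:M; rewrite ZE -!scalar_mxM.
by move=> /matrixP/(_ 0 0); rewrite !mxE eqxx !mulr1n.
Qed.

(** Fullness of [e] extends [z] to a central idempotent [Z] of the whole matrix ring with
    [e *m Z = z]. A central matrix is scalar, so [Z] comes from a central idempotent of [A], which
    is 0 or 1. *)
Lemma corner_central (K : fieldType) (A : falgType K) n (e z : 'M[A]_n.+1) :
  connected_alg A -> full_idem e -> z *m z = z -> e *m z = z -> z *m e = z ->
  (forall M, e *m M *m e = M -> z *m M = M *m z) -> z = 0 \/ z = e.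
Proof.
move=> conn [ee [s s1]] zz ez ze cz.
have swap M : z *m M *m e = e *m M *m z.
  have := cz (e *m M *m e); rewrite !mulmxA ee -[_ *m e *m e]mulmxA ee => /(_ erefl).
  by rewrite ze -[_ *m e *m z]mulmxA ez.
pose Z := \sum_(ab <- s) ab.1 *m z *m ab.2.
have eZ : e *m Z = z.
  rewrite -[RHS]mulmx1 -s1 /Z !mulmx_sumr; apply: eq_bigr => ab _.
  by rewrite !mulmxA -swap.
have Z2 M : M *m Z =
    \sum_(ab <- s) \sum_(cd <- s) ab.1 *m (e *m (ab.2 *m M *m cd.1) *m z) *m cd.2.
  rewrite -[M *m Z]mul1mx -s1 mulmx_suml; apply: eq_bigr => ab _.
  by rewrite /Z !mulmx_sumr; apply: eq_bigr => cd _; rewrite !mulmxA.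
have cZ M : Z *m M = M *m Z.
  rewrite Z2 exchange_big /= -[LHS]mulmx1 -s1 mulmx_sumr; apply: eq_bigr => cd _.
  rewrite /Z !mulmx_suml; apply: eq_bigr => ab _.
  by rewrite -swap !mulmxA.
have zZ : z *m Z = z by rewrite -{1}ze -mulmxA eZ.
have ZZ : Z *m Z = Z.
  rewrite {1}/Z mulmx_suml; apply: eq_bigr => ab _.
  by rewrite -mulmxA -cZ mulmxA -[_ *m z *m Z]mulmxA zZ.
have [c Zc cc] := central_mx_scalar cZ.
have c2 : c * c = c.
  move: ZZ; rewrite Zc -scalar_mxM => /matrixP/(_ 0 0).
  by rewrite !mxE eqxx !mulr1n.
case: (conn c c2) => [a|c0|c1]; first by rewrite cc.
- by left; rewrite -eZ Zc c0 raddf0 mulmx0.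
- by right; rewrite -eZ Zc c1 mulmx1.
Qed.

Lemma in_ideal_size (K : fieldType) (L : bquiver K) u (q : qpath (bq L)) :
  in_ideal (@brels K L) u -> pvalid q -> (size q.2 < 2)%N -> coeff u q = 0.
Proof.
case=> s us vq q2; rewrite us // /coeff big_flatten big_map big1 // => t _.
have := brels_wf (proj2_sig t.1.2); move: (t.1.1.1) (t.1.1.2) (proj1_sig t.1.2) (t.2).
move=> c a r b /allP wf; rewrite /rel_mult; case: ifP => _; last by rewrite big_nil.
rewrite big_map big_seq_cond big1 // => ct /andP[/wf/and3P[_ _ ct2] /andP[_ /eqP e]].
by move: q2; rewrite -e /= !size_cat; lia.
Qed.

(** * Connected algebras whose quiver has at most one loop per vertex *)

Section OneVertex.
Variables (K : fieldType) (A : falgType K) (L : bquiver K).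
Hypotheses (conn : connected_alg A).
Hypothesis loops : forall a : arr (bq L), src a = tgt a.
Hypothesis single : forall a b : arr (bq L), src a = src b -> a = b.

Lemma morita_loops_trunc : morita_bq A L -> exists m : nat, (0 < m)%N /\ morita_trunc_poly A m.
Proof.
case=> n [e [fe [E [X [EE [EF [Ee [XE]]]]]]]].
move=> /[let] peval /[let] eval [ker onto]; have [ee [s s1]] := fe.
have e0 : e != 0.
  apply/eqP => e0; have := s1; rewrite big1 => [|ab _]; last by rewrite e0 mulmx0 mul0mx.
  by move=> /matrixP/(_ 0 0)/eqP; rewrite !mxE eq_sym oner_eq0.
have eE y : e *m E y = E y.
  rewrite -Ee mulmx_suml (bigD1 y) //= EE big1 ?addr0 // => z zy; exact: EF.
have Ee' y : E y *m e = E y.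
  by rewrite -Ee mulmx_sumr (bigD1 y) //= EE big1 ?addr0 // => z zy; rewrite EF // eq_sym.
have eval1 q : eval [:: (1, q)] = peval q by rewrite /eval big_seq1 kscale1.
(* Otherwise the trivial path at [y] would be in the ideal, whose elements involve only paths of
   length at least 2. *)
have E0 y : E y != 0.
  apply/eqP => Ey0; have /ker : eval [:: (1, (y, [::]))] = 0 by rewrite eval1 /peval.
  move=> /(@in_ideal_size _ _ _ (y, [::])) /(_ isT isT).
  by rewrite /coeff big_cons big_nil /= eqxx addr0 => /eqP; rewrite oner_eq0.
have loop_path y w : valid_from y w -> forall M, E y *m M = M -> M *m E y = M ->
    let N := foldl (fun acc a => X a *m acc) M w in E y *m N = N /\ N *m E y = N.
  elim: w => [|a w IHw] //= /andP[/eqP sa vw] M EM ME; rewrite -loops sa in vw.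
  apply: IHw => //; last by rewrite -mulmxA ME.
  by rewrite [X a]XE !mulmxA -loops sa EE.
(* All arrows are loops, so each path lies in the corner of a single [E z]; hence [E y] is central
   in the corner of [e], and connectedness makes it equal to [e]. *)
have comm y M : e *m M *m e = M -> E y *m M = M *m E y.
  move=> /onto[u <-]; rewrite /eval mulmx_sumr mulmx_suml; apply: eq_bigr => -[c [z w]] _.
  rewrite kscale_mulr kscale_mull; congr (kscale _ _); rewrite /peval /pvalid /=.
  case: ifP => [vw|_]; last by rewrite mulmx0 mul0mx.
  have [/= EN NE] := loop_path z w vw (E z) (EE z) (EE z).
  have [->|yz] := eqVneq y z; first by rewrite EN NE.
  by rewrite -[in LHS]EN -[in RHS]NE mulmxA EF // mul0mx -mulmxA EF ?mulmx0 // eq_sym.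
have Eone y : E y = e.
  case: (corner_central conn fe (EE y) (eE y) (Ee' y) (comm y)) => // Ey0.
  by have := E0 y; rewrite Ey0 eqxx.
have vert1 (y z : vert (bq L)) : y = z.
  apply/eqP/negPn/negP => /EF; rewrite !Eone ee => /eqP.
  by rewrite (negbTE e0).
have [y0 _] : exists y : vert (bq L), True.
  apply: NNPP => ny; case/eqP: e0; rewrite -Ee big1 // => y _.
  by case: ny; exists y.
have arr1 (a b : arr (bq L)) : a = b by apply: single; apply: vert1.
pose x := if [pick a : arr (bq L)] is Some a then X a else 0.
have Xx a : X a = x.
  by rewrite /x; case: pickP => [b _|/(_ a)//]; rewrite (arr1 a b).
have exe : e *m x *m e = x.
  rewrite /x; case: pickP => [a _|_]; last by rewrite mulmx0 mul0mx.
  by rewrite [in RHS]XE !Eone.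
have pevalE q : pvalid q -> peval q = e *m x ^+ (size q.2).
  case: q => y w vq; rewrite /peval vq /= Eone -(expx_e ee exe).
  elim/last_ind: w {vq} => [|w a IHw] /=; first by rewrite expr0 mul1mx.
  by rewrite foldl_rcons IHw size_rcons exprS mulmxA Xx.
(* With a loop, [bnilp] makes its long powers vanish; without one, [x = 0] and exponent 1
   suffices. *)
have [N evN] : exists N, evp e x 'X^N = 0.
  rewrite /x; case: pickP => [a _|na]; last by exists 1%N; rewrite evpXn expr1 mulmx0.
  have [N HN] := bnilp L; exists N; rewrite evpXn.
  have vN : pvalid (y0, nseq N a).
    rewrite /pvalid /=; elim: N {HN} => //= N IHN.
    by rewrite (vert1 (src a) y0) (vert1 (tgt a) y0) eqxx IHN.
  have := HN _ vN; rewrite /= size_nseq leqnn => /(_ isT)/ker.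
  by rewrite eval1 pevalE //= size_nseq Xx /x.
have [m [m0 kerm]] := evp_kernel ee exe e0 evN.
exists m; split=> //; exists n, e; split=> //; exists x; split=> //.
split=> [p|M /onto[u <-]]; first exact: kerm.
(* Invalid paths evaluate to 0, so they contribute coefficient 0. *)
pose pol : {poly K} := \sum_(c <- u) (if pvalid c.2 then c.1 else 0) *: 'X^(size c.2.2).
exists pol; rewrite -/(evp e x pol) evp_sum; apply: eq_bigr => c _.
rewrite evpZ evpXn; case: ifP => vc; first by rewrite pevalE.
by rewrite kscale0l /peval vc kscale0r.
Qed.

End OneVertex.

Theorem theorem5p1 (K : closedFieldType) (A : falgType K) :
  connected_alg A ->
  (hom_irreducible_alg A <-> exists m : nat, (0 < m)%N /\ morita_trunc_poly A m).
Proof.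
move=> conn; split=> [[L [mor irr]]|[m [m_gt0 mor]]]; last first.
  exists (loop_bquiver K m_gt0); split; first exact: morita_loop.
  exact: loop_hom_irreducible.
have loops (a : arr (bq L)) : src a = tgt a.
  by apply: NNPP => na; apply: (nonloop_reducible na irr).
apply: (morita_loops_trunc conn loops _ mor) => a b ab.
apply: NNPP => nab; apply: (two_loops_reducible nab _ _ _ irr) => //.
by rewrite -loops -ab.
Qed.
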